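(* Let $n\geq 3$, fix $0<\rho<1$ and put $\delta:=\frac{n-2}{n}\rho$. Define, for $t\in[-1,1]$, \begin{align*} F(t) &:= \int_{-1}^{1} |\delta t-x| (1-x^2)^{\frac {n-3}{2}}\, dx,\\ G(t) &:= (n-2)\rho t \int_{-1}^{1} |\delta t-x| (1-x^2)^{\frac {n-3}{2}} x\, dx,\\ H(t) &:= \frac {2}{n^2-1} (1-\delta^2 t^2)^{\frac {n+1}{2}} \sum_{k=2}^{\infty} \frac {(k-2)!}{(n+2)_{k-2}} C_{k-2}^{\frac {n+2}{2}}(\delta t)\, C_{k}^{\frac {n-2}{2}}(t)\, \rho^{k}. \end{align*} Then the function $F+G+H$ is convex on $[-1,1]$.
   Context: $C_k^\lambda$ is the Gegenbauer polynomial of degree $k$ associated to $\lambda$, defined by $(1-2xz+z^2)^{-\lambda}=\sum_{k\ge0}C_k^\lambda(x)z^k$; $(a)_0=1$, $(a)_k=a(a+1)\cdots(a+k-1)$ is the Pochhammer symbol. *)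

(* Defs.v *)
From Stdlib Require Import Reals Lra Arith.
From Coquelicot Require Import Coquelicot.
Open Scope R_scope.

Fixpoint poch (a : R) (k : nat) : R :=
  match k with
  | O => 1
  | S k' => poch a k' * (a + INR k')
  end.

(* Gegenbauer polynomial C_k^lam(x): the coefficient of z^k in
   (1 - 2 x z + z^2)^(-lam), written out explicitly:
   sum_{j=0}^{floor(k/2)} (-1)^j (lam)_{k-j} / (j! (k-2j)!) (2x)^(k-2j). *)
Definition gegenbauer (lam : R) (k : nat) (x : R) : R :=
  sum_f_R0 (fun j => (-1) ^ j * poch lam (k - j)
                      / (INR (Factorial.fact j) * INR (Factorial.fact (k - 2 * j)))
                      * (2 * x) ^ (k - 2 * j)) (Nat.div2 k).

Definition delta (n : nat) (rho : R) : R := (INR n - 2) / INR n * rho.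

(* (1-x^2)^((n-3)/2) is written as sqrt(1-x^2)^(n-3) (equal on [-1,1]). *)
Definition F (n : nat) (rho t : R) : R :=
  RInt (fun x => Rabs (delta n rho * t - x) * sqrt (1 - x ^ 2) ^ (n - 3)) (-1) 1.

Definition G (n : nat) (rho t : R) : R :=
  (INR n - 2) * rho * t *
  RInt (fun x => Rabs (delta n rho * t - x) * sqrt (1 - x ^ 2) ^ (n - 3) * x) (-1) 1.

(* (1 - delta^2 t^2)^((n+1)/2) written as sqrt(1 - delta^2 t^2)^(n+1);
   the series over k >= 2 is reindexed as k = j + 2. *)
Definition H (n : nat) (rho t : R) : R :=
  2 / (INR n ^ 2 - 1) * sqrt (1 - (delta n rho) ^ 2 * t ^ 2) ^ (n + 1) *
  Series (fun j : nat =>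
    INR (Factorial.fact j) / poch (INR n + 2) j
    * gegenbauer ((INR n + 2) / 2) j (delta n rho * t)
    * gegenbauer ((INR n - 2) / 2) (j + 2) t
    * rho ^ (j + 2)).

Definition convex_on_interval (f : R -> R) (a b : R) : Prop :=
  forall x y l, a <= x <= b -> a <= y <= b -> 0 <= l <= 1 ->
    f (l * x + (1 - l) * y) <= l * f x + (1 - l) * f y.

(* Main.v *)
Require Import Defs.
From Stdlib Require Import Reals Lra Lia Arith.
From Coquelicot Require Import Coquelicot.
Open Scope R_scope.

(** Write [lam = (n-2)/2], [a = delta t], [N_k = C_k / C_k(1)] and [f = F + G + H].  Then
    [f] is a sum over all [k >= 0] of terms [A_k(a) C_k(t)] with
    [A_k'' = 2 rho^k N_k^lam (1-a^2)^(lam-1/2)], and the Gegenbauer equation makes every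
    term, hence [f], satisfy [(1-t^2) f'' + (2 lam+1) (f - t f') = E(t)].  Therefore
    [(1-t^2)^(lam+1/2) (f - t f')] is the integral of [s E(s) (1-s^2)^(lam-1/2)] over [[t,1]],
    and [f'' >= 0] follows as soon as [E] is nonincreasing on [[0,1)].  (This is carried out
    on partial sums, with an error that tends to [0], so that no series is differentiated.)

    By the product formula and the generating function the series in [E] sum to averages of
    [X^(-lam)], [X = A - B cos(theta)], against [sin(theta)^(2 lam-1)], and [E] becomes
    [2/(lam+1) (1-a^2)^(lam-1/2) <(1 - delta rho) X^(-lam) + lam X^(1-lam)>].
    With [K = <X^(-lam)>], [J = <X^(1-lam)>] and [D^2 = A^2 - B^2], integration by parts gives
    [<X^(-lam-1)> = J / D^2], so [E' <= 0] is linear in [(K, J)].  As [D^2] is affine in [t^2],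
    this linear inequality, tested at the two bounds [D K <= J] and
    [(2 lam+1) J <= (2 lam D + A) K], becomes a polynomial inequality in [D] with nonnegative
    coefficients in suitable variables. *)

(** * Gegenbauer polynomials *)

(** The operator [(1-t^2) f'' + (2 lam+1) (f - t f')] is chosen so that [A_k] itself drops out:
    [A_k], in the variable [a], and [C_k] solve second order equations with the same eigenvalue
    [k (k + 2 lam)]. What is left are the products [A_k'' C_k] and [A_k' C_k']. Up to explicit
    factors these are [rho^k N_k C_k] for the parameters [lam] and [lam+1], so their sums are
    Poisson-type kernels with a closed form.

    The product formula is obtained as a uniqueness statement for an equation that is singular at
    angle 0; a decreasing energy replaces the Lipschitz argument there. The energy decreases only up
    to [PI / 2], which restricts the kernel to [t >= 0]; negative [t] is reached because each term
    has an even second derivative.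

    Two bounds on [J] are needed because its coefficient in [E' <= 0] can have either sign; both
    bounds are equalities when [B = 0], that is at [t = 1]. For [n = 3], where [lam = 1/2], that
    coefficient is nonnegative and the lower bound is enough. The averages use the angle as variable
    because for [n = 3] the weight in [v] is unbounded. *)

Lemma poch_shift (a : R) (k : nat) : poch a (S k) = a * poch (a + 1) k.
Proof.
  induction k as [|k IH]; [simpl; ring|].
  change (poch a (S (S k))) with (poch a (S k) * (a + INR (S k))).
  rewrite IH, S_INR; simpl poch; ring.
Qed.

Lemma poch_pos (a : R) (k : nat) : 0 < a -> 0 < poch a k.
Proof.
  intros Ha; induction k as [|k IH]; simpl; [lra|].
  apply Rmult_lt_0_compat; [exact IH|]. pose proof (pos_INR k); lra.
Qed.

Lemma half_succ_pos (m : nat) : 0 < (INR m + 1) / 2.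
Proof. pose proof (pos_INR m); lra. Qed.

(* Terms with [2 j > k] are set to [0], so that sums for different [k] share a range. *)
Definition gterm (lam : R) (k : nat) (x : R) (j : nat) : R :=
  if (2 * j <=? k)%nat then
    (-1) ^ j * poch lam (k - j)
      / (INR (Factorial.fact j) * INR (Factorial.fact (k - 2 * j)))
      * (2 * x) ^ (k - 2 * j)
  else 0.

Lemma gterm_in (lam : R) (r j : nat) (x : R) :
  gterm lam (2 * j + r) x j
  = (-1) ^ j * poch lam (j + r) / (INR (Factorial.fact j) * INR (Factorial.fact r))
    * (2 * x) ^ r.
Proof.
  unfold gterm. destruct (Nat.leb_spec (2 * j) (2 * j + r)); [|lia].
  replace (2 * j + r - j)%nat with (j + r)%nat by lia.
  replace (2 * j + r - 2 * j)%nat with r by lia. reflexivity.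
Qed.

Lemma gterm_out (lam : R) (k j : nat) (x : R) : (k < 2 * j)%nat -> gterm lam k x j = 0.
Proof. intros; unfold gterm. destruct (Nat.leb_spec (2 * j) k); [lia|reflexivity]. Qed.

Lemma gegenbauer_sum (lam : R) (k N : nat) (x : R) :
  (k <= 2 * N + 1)%nat -> gegenbauer lam k x = sum_f_R0 (gterm lam k x) N.
Proof.
  intros HN. unfold gegenbauer.
  assert (Hd := Nat.div2_odd k).
  assert (Hb : (Nat.b2n (Nat.odd k) <= 1)%nat) by (destruct (Nat.odd k); simpl; lia).
  assert (Hle : (Nat.div2 k <= N)%nat) by lia.
  transitivity (sum_f_R0 (gterm lam k x) (Nat.div2 k)).
  { apply sum_eq; intros j Hj. unfold gterm.
    destruct (Nat.leb_spec (2 * j) k); [reflexivity|lia]. }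
  clear HN. induction Hle as [|N Hle IH]; [reflexivity|].
  rewrite tech5, <- IH, gterm_out; [ring|lia].
Qed.

Lemma fact_ne (k : nat) : INR (Factorial.fact k) <> 0.
Proof. apply INR_fact_neq_0. Qed.

Lemma INR_fact_S (k : nat) :
  INR (Factorial.fact (S k)) = (INR k + 1) * INR (Factorial.fact k).
Proof.
  change (Factorial.fact (S k)) with (S k * Factorial.fact k)%nat.
  rewrite mult_INR, S_INR; ring.
Qed.

(** With [Q = 1 - 2 x z + z^2], this is the coefficient of [z^(k+1)] in
    [d/dz Q^(-lam) = 2 lam (x - z) Q^(-lam-1)]. The explicit terms are compared, with [j = 0] apart
    because the last sum is shifted by one. *)
Lemma gegenbauer_lower (lam : R) (k : nat) (x : R) :
  (INR k + 2) * gegenbauer lam (k + 2) x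
  = 2 * lam * (x * gegenbauer (lam + 1) (k + 1) x - gegenbauer (lam + 1) k x).
Proof.
  rewrite (gegenbauer_sum lam (k + 2) (S k)), (gegenbauer_sum (lam + 1) (k + 1) (S k)),
    (gegenbauer_sum (lam + 1) k k) by lia.
  rewrite (decomp_sum (gterm lam _ x)), (decomp_sum (gterm (lam + 1) (k + 1) x)) by lia.
  simpl Nat.pred.
  assert (H0 : (INR k + 2) * gterm lam (k + 2) x 0
                = 2 * lam * x * gterm (lam + 1) (k + 1) x 0).
  { rewrite (gterm_in lam (k + 2) 0), (gterm_in (lam + 1) (k + 1) 0).
    simpl Nat.add. replace (k + 2)%nat with (S (k + 1)) by lia.
    rewrite INR_fact_S, poch_shift, plus_INR. simpl pow. simpl (INR (Factorial.fact 0)).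
    simpl (INR 1). field. repeat split; auto using fact_ne.
    pose proof (pos_INR k); lra. }
  assert (HS : (INR k + 2) * sum_f_R0 (fun i => gterm lam (k + 2) x (S i)) k
     = 2 * lam * x * sum_f_R0 (fun i => gterm (lam + 1) (k + 1) x (S i)) k
       - 2 * lam * sum_f_R0 (gterm (lam + 1) k x) k).
  { rewrite !scal_sum, <- minus_sum. apply sum_eq; intros j _.
    destruct (le_lt_dec (2 * j) k) as [Hj|Hj].
    2:{ rewrite !gterm_out by lia. ring. }
    destruct (Nat.le_exists_sub (2 * j) k Hj) as [r [-> _]].
    replace (r + 2 * j + 2)%nat with (2 * S j + r)%nat by lia.
    replace (r + 2 * j)%nat with (2 * j + r)%nat by lia.
    rewrite !gterm_in.
    replace (S j + r)%nat with (S (j + r)) by lia.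
    rewrite poch_shift.
    destruct r as [|r].
    - rewrite gterm_out by lia. rewrite INR_fact_S, plus_INR, mult_INR.
      replace (j + 0)%nat with j by lia.
      simpl pow. simpl (INR (Factorial.fact 0)). simpl (INR 2). simpl (INR 0). field.
      split; auto using fact_ne. pose proof (pos_INR j); lra.
    - replace (2 * j + S r + 1)%nat with (2 * S j + r)%nat by lia.
      rewrite gterm_in.
      rewrite !INR_fact_S, plus_INR, mult_INR, (S_INR r).
      replace (j + S r)%nat with (S j + r)%nat by lia.
      simpl pow. simpl (INR 2). field.
      repeat split; auto using fact_ne; [pose proof (pos_INR r)|pose proof (pos_INR j)]; lra. }
  rewrite Rmult_plus_distr_l, H0, HS. ring.
Qed.

(** The coefficient of [z^(k+2)] in [(z d/dz + lam) Q^(-lam) = lam (1 - z^2) Q^(-lam-1)], with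
    [Q = 1 - 2 x z + z^2]. *)
Lemma gegenbauer_raise (lam : R) (k : nat) (x : R) :
  (INR k + 2 + lam) * gegenbauer lam (k + 2) x
  = lam * (gegenbauer (lam + 1) (k + 2) x - gegenbauer (lam + 1) k x).
Proof.
  rewrite (gegenbauer_sum lam (k + 2) (S k)), (gegenbauer_sum (lam + 1) (k + 2) (S k)),
    (gegenbauer_sum (lam + 1) k k) by lia.
  rewrite (decomp_sum (gterm lam _ x)), (decomp_sum (gterm (lam + 1) (k + 2) x)) by lia.
  simpl Nat.pred.
  assert (Hp : forall m, lam * poch (lam + 1) m = poch lam m * (lam + INR m)).
  { intros m. rewrite <- poch_shift. reflexivity. }
  assert (H0 : (INR k + 2 + lam) * gterm lam (k + 2) x 0
                = lam * gterm (lam + 1) (k + 2) x 0).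
  { rewrite (gterm_in lam (k + 2) 0), (gterm_in (lam + 1) (k + 2) 0).
    simpl Nat.add.
    transitivity ((lam * poch (lam + 1) (k + 2)) * (2 * x) ^ (k + 2)
      / INR (Factorial.fact (k + 2))).
    - rewrite Hp, plus_INR. simpl (INR (Factorial.fact 0)). simpl (INR 2). simpl ((-1) ^ 0).
      field; auto using fact_ne.
    - simpl (INR (Factorial.fact 0)). simpl ((-1) ^ 0). field; auto using fact_ne. }
  assert (HS : (INR k + 2 + lam) * sum_f_R0 (fun i => gterm lam (k + 2) x (S i)) k
     = lam * sum_f_R0 (fun i => gterm (lam + 1) (k + 2) x (S i)) k
       - lam * sum_f_R0 (gterm (lam + 1) k x) k).
  { rewrite !scal_sum, <- minus_sum. apply sum_eq; intros j _.
    destruct (le_lt_dec (2 * j) k) as [Hj|Hj].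
    2:{ rewrite !gterm_out by lia. ring. }
    destruct (Nat.le_exists_sub (2 * j) k Hj) as [r [-> _]].
    replace (r + 2 * j + 2)%nat with (2 * S j + r)%nat by lia.
    replace (r + 2 * j)%nat with (2 * j + r)%nat by lia.
    rewrite !gterm_in.
    replace (S j + r)%nat with (S (j + r)) by lia.
    assert (E : poch lam (S (j + r)) = lam * poch (lam + 1) (j + r)) by apply poch_shift.
    rewrite E.
    change (poch (lam + 1) (S (j + r)))
      with (poch (lam + 1) (j + r) * (lam + 1 + INR (j + r))).
    rewrite INR_fact_S, !plus_INR, mult_INR. simpl pow. simpl (INR 2). field.
    repeat split; auto using fact_ne. pose proof (pos_INR j); lra. }
  rewrite Rmult_plus_distr_l, H0, HS. ring.
Qed.

Lemma gegenbauer_0 (lam x : R) : gegenbauer lam 0 x = 1.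
Proof. unfold gegenbauer; simpl; field. Qed.

Lemma gegenbauer_1 (lam x : R) : gegenbauer lam 1 x = 2 * lam * x.
Proof. unfold gegenbauer; simpl; field. Qed.

(** Twice [gegenbauer_raise] minus [gegenbauer_lower]. *)
Lemma gegenbauer_raise_mixed (lam : R) (k : nat) (x : R) :
  (INR k + 1 + 2 * lam) * gegenbauer lam (k + 1) x
  = 2 * lam * (gegenbauer (lam + 1) (k + 1) x - x * gegenbauer (lam + 1) k x).
Proof.
  destruct k as [|k].
  - simpl Nat.add. rewrite !gegenbauer_1, !gegenbauer_0. simpl INR. ring.
  - replace (S k + 1)%nat with (k + 2)%nat by lia.
    replace (S k) with (k + 1)%nat by lia. rewrite plus_INR. simpl (INR 1).
    pose proof (gegenbauer_raise lam k x). pose proof (gegenbauer_lower lam k x). lra.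
Qed.

Lemma gegenbauer_rec (lam : R) (k : nat) (x : R) :
  (INR k + 2) * gegenbauer lam (k + 2) x
  = 2 * (INR k + 1 + lam) * x * gegenbauer lam (k + 1) x
    - (INR k + 2 * lam) * gegenbauer lam k x.
Proof.
  destruct k as [|k].
  - pose proof (gegenbauer_lower lam 0 x) as H. simpl Nat.add in *.
    rewrite H, !gegenbauer_1, !gegenbauer_0. simpl INR. ring.
  - pose proof (gegenbauer_lower lam (S k) x) as H1.
    pose proof (gegenbauer_raise_mixed lam (S k) x) as H2.
    pose proof (gegenbauer_raise_mixed lam k x) as H3.
    pose proof (gegenbauer_lower lam k x) as H4.
    replace (k + 2)%nat with (S k + 1)%nat in * by lia.
    replace (k + 1)%nat with (S k) in * by lia.
    rewrite !S_INR in *.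
    set (c0 := gegenbauer lam (S k) x) in *. set (c1 := gegenbauer lam (S k + 1) x) in *.
    set (c2 := gegenbauer lam (S k + 2) x) in *.
    set (e0 := gegenbauer (lam + 1) k x) in *.
    set (e1 := gegenbauer (lam + 1) (S k) x) in *.
    set (e2 := gegenbauer (lam + 1) (S k + 1) x) in *.
    (* The splitting [2 (k+2+lam) = (k+2+2 lam) + (k+2)] lets the mixed and the lowering relation
       act on one summand each, so that only the parameter [lam + 1] remains. *)
    replace (2 * (INR k + 1 + 1 + lam) * x * c1)
      with (x * ((INR k + 1 + 1 + 2 * lam) * c1) + x * ((INR k + 2) * c1)) by ring.
    rewrite H1, H2, H4. replace ((INR k + 1 + 2 * lam) * c0) with
      (2 * lam * (e1 - x * e0)) by lra. ring.
Qed.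

(** * Derivatives and the Gegenbauer differential equation *)

Definition dgeg (lam : R) (k : nat) (x : R) : R :=
  match k with O => 0 | S k' => 2 * lam * gegenbauer (lam + 1) k' x end.

Definition ddgeg (lam : R) (k : nat) (x : R) : R :=
  match k with O => 0 | S k' => 2 * lam * dgeg (lam + 1) k' x end.

Lemma is_derive_sum_f_R0 (f df : nat -> R -> R) (N : nat) (x : R) :
  (forall j, is_derive (f j) x (df j x)) ->
  is_derive (fun y => sum_f_R0 (fun j => f j y) N) x (sum_f_R0 (fun j => df j x) N).
Proof.
  intros Hf; induction N as [|N IH]; simpl; [apply Hf|].
  apply (is_derive_plus (fun y => sum_f_R0 (fun j => f j y) N) (f (S N))); auto.
Qed.

Lemma is_derive_gegenbauer (lam : R) (k : nat) (x : R) :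
  is_derive (gegenbauer lam k) x (dgeg lam k x).
Proof.
  destruct k as [|k]; simpl dgeg.
  - apply (is_derive_ext (fun _ => 1)); [intros; symmetry; apply gegenbauer_0|].
    apply @is_derive_const.
  - apply (is_derive_ext (fun y => sum_f_R0 (fun j => gterm lam (S k) y j) k)).
    { intros; symmetry; apply gegenbauer_sum; lia. }
    rewrite (gegenbauer_sum (lam + 1) k k) by lia. rewrite scal_sum.
    apply (is_derive_sum_f_R0 (fun j y => gterm lam (S k) y j)
             (fun j y => gterm (lam + 1) k y j * (2 * lam))).
    intros j. destruct (le_lt_dec (2 * j) k) as [Hj|Hj].
    + destruct (Nat.le_exists_sub (2 * j) k Hj) as [r [-> _]].
      replace (r + 2 * j)%nat with (2 * j + r)%nat by lia.
      rewrite gterm_in.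
      apply (is_derive_ext (fun y => (-1) ^ j * poch lam (S (j + r))
        / (INR (Factorial.fact j) * INR (Factorial.fact (S r))) * (2 * y) ^ S r)).
      { intros y. replace (S (2 * j + r)) with (2 * j + S r)%nat by lia.
        rewrite gterm_in. replace (j + S r)%nat with (S (j + r)) by lia. reflexivity. }
      rewrite poch_shift, INR_fact_S.
      set (c := (-1) ^ j * (lam * poch (lam + 1) (j + r))
                / (INR (Factorial.fact j) * ((INR r + 1) * INR (Factorial.fact r)))).
      replace ((-1) ^ j * _ / _ * _ * _) with (c * (INR (S r) * 2 * (2 * x) ^ r)).
      { auto_derive; [exact I|]. simpl; ring. }
      unfold c. rewrite S_INR. field.
      repeat split; auto using fact_ne. pose proof (pos_INR r); lra.
    + rewrite (gterm_out (lam + 1)) by lia. rewrite Rmult_0_l.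
      apply (is_derive_ext (fun _ => gterm lam (S k) x j)); [|apply @is_derive_const].
      (* Here the differentiated sum has no term. Either [S k = 2 * j] and the original term is the
         constant one, [(2 y)^0], or it is out of range as well. *)
      intros y. destruct (Nat.eq_dec (S k) (2 * j)) as [e|ne].
      * rewrite e. replace (2 * j)%nat with (2 * j + 0)%nat by lia.
        rewrite !gterm_in. simpl. reflexivity.
      * rewrite !gterm_out by lia. reflexivity.
Qed.

Lemma is_derive_dgeg (lam : R) (k : nat) (x : R) :
  is_derive (dgeg lam k) x (ddgeg lam k x).
Proof.
  destruct k as [|k]; simpl; [apply @is_derive_const|].
  apply (is_derive_scal (gegenbauer (lam + 1) k)). apply is_derive_gegenbauer.
Qed.

Lemma gegenbauer_ode (lam : R) (k : nat) (x : R) :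
  (1 - x ^ 2) * ddgeg lam k x - (2 * lam + 1) * x * dgeg lam k x
  + INR k * (INR k + 2 * lam) * gegenbauer lam k x = 0.
Proof.
  destruct k as [|[|k]].
  - simpl; ring.
  - simpl dgeg; simpl ddgeg. rewrite gegenbauer_0, gegenbauer_1. simpl INR; ring.
  - unfold ddgeg, dgeg. pose proof (gegenbauer_lower lam k x) as H1.
    replace (k + 2)%nat with (S (S k)) in H1 by lia.
    replace (k + 1)%nat with (S k) in H1 by lia.
    replace (INR (S (S k))) with (INR k + 2) by (rewrite !S_INR; ring).
    replace ((INR k + 2) * (INR k + 2 + 2 * lam) * gegenbauer lam (S (S k)) x)
      with ((INR k + 2 + 2 * lam) * ((INR k + 2) * gegenbauer lam (S (S k)) x)) by ring.
    rewrite H1.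
    (* Up to the factor [2 * lam], the equation has become the first order formula for [(1 - x^2)]
       times the derivative of the polynomial of degree [S k] and parameter [lam + 1]. *)
    enough (E : (1 - x ^ 2) * (2 * (lam + 1) * gegenbauer (lam + 1 + 1) k x)
      = - (INR k + 1) * x * gegenbauer (lam + 1) (S k) x
        + (INR k + 2 * (lam + 1)) * gegenbauer (lam + 1) k x).
    { replace ((1 - x ^ 2) * (2 * lam * (2 * (lam + 1) * gegenbauer (lam + 1 + 1) k x)))
      with (2 * lam * ((1 - x ^ 2) * (2 * (lam + 1) * gegenbauer (lam + 1 + 1) k x))) by ring.
      rewrite E; ring. }
    destruct k as [|k].
    + rewrite !gegenbauer_0, gegenbauer_1. simpl INR. ring.
    + pose proof (gegenbauer_lower (lam + 1) k x) as H2.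
      pose proof (gegenbauer_raise_mixed (lam + 1) k x) as H3.
      replace (k + 2)%nat with (S (S k)) in * by lia.
      replace (k + 1)%nat with (S k) in * by lia.
      rewrite S_INR.
      replace (- (INR k + 1 + 1) * x * gegenbauer (lam + 1) (S (S k)) x)
        with (- x * ((INR k + 2) * gegenbauer (lam + 1) (S (S k)) x)) by ring.
      rewrite H2, H3. ring.
Qed.

(** Both sides obey the three-term recurrence, so the induction carries two consecutive values. *)
Lemma gegenbauer_at_1 (lam : R) (k : nat) :
  gegenbauer lam k 1 = poch (2 * lam) k / INR (Factorial.fact k).
Proof.
  enough (H : forall k, gegenbauer lam k 1 = poch (2 * lam) k / INR (Factorial.fact k)
    /\ gegenbauer lam (k + 1) 1 = poch (2 * lam) (k + 1) / INR (Factorial.fact (k + 1)))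
    by apply H.
  clear k; induction k as [|k [IH1 IH2]].
  - simpl Nat.add. rewrite gegenbauer_0, gegenbauer_1. simpl. split; field.
  - replace (S k) with (k + 1)%nat by lia. split; [exact IH2|].
    replace (k + 1 + 1)%nat with (k + 2)%nat by lia.
    pose proof (pos_INR k).
    apply (Rmult_eq_reg_l (INR k + 2)); [|lra].
    rewrite gegenbauer_rec, IH1, IH2.
    replace (k + 2)%nat with (S (S k)) by lia. replace (k + 1)%nat with (S k) by lia.
    rewrite !INR_fact_S, S_INR. simpl poch.
    change (match k with O => 1 | S _ => INR k + 1 end) with (INR (S k)). rewrite S_INR.
    field. repeat split; auto using fact_ne; lra.
Qed.

Lemma gegenbauer_opp (lam : R) (k : nat) (x : R) :
  gegenbauer lam k (- x) = (-1) ^ k * gegenbauer lam k x.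
Proof.
  rewrite !(gegenbauer_sum lam k k) by lia. rewrite scal_sum.
  apply sum_eq; intros j _.
  destruct (le_lt_dec (2 * j) k) as [Hj|Hj].
  - destruct (Nat.le_exists_sub (2 * j) k Hj) as [r [-> _]].
    replace (r + 2 * j)%nat with (2 * j + r)%nat by lia. rewrite !gterm_in.
    replace (2 * - x) with (-1 * (2 * x)) by ring.
    rewrite Rpow_mult_distr, pow_add, pow_mult.
    replace ((-1) ^ 2) with 1 by ring. rewrite pow1. ring.
  - rewrite !gterm_out by lia. ring.
Qed.

(** * Sonine's energy argument *)

(** The derivative of the energy is [-4 lam cot(p) Y1^2 / mu], which is nonpositive up to [PI / 2].
    The lemma serves twice: it bounds Gegenbauer polynomials by their value at 1, and for a solution
    with zero energy at 0 it yields uniqueness despite the singularity of the equation at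
    [p = 0]. *)
Lemma energy_decreasing (lam mu : R) (Y Y1 Y2 : R -> R) :
  0 <= lam -> 0 < mu ->
  (forall p, is_derive Y p (Y1 p)) -> (forall p, is_derive Y1 p (Y2 p)) ->
  (forall p, sin p * Y2 p + 2 * lam * cos p * Y1 p + mu * sin p * Y p = 0) ->
  forall p, 0 <= p <= PI / 2 -> Y p ^ 2 + Y1 p ^ 2 / mu <= Y 0 ^ 2 + Y1 0 ^ 2 / mu.
Proof.
  intros Hlam Hmu HY HY1 Hode p [Hp0 Hp].
  destruct (Req_dec p 0) as [->|Hne]; [apply Rle_refl|].
  destruct (MVT_cor2 (fun q => Y q ^ 2 + Y1 q ^ 2 / mu)
    (fun q => 2 * Y q * Y1 q + 2 * Y1 q * Y2 q / mu) 0 p) as [c [Hc [Hc0 Hcp]]].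
  - lra.
  - intros c _. apply is_derive_Reals.
    specialize (HY c). specialize (HY1 c).
    auto_derive; [repeat split; eexists; eauto|].
    rewrite (is_derive_unique _ _ _ HY : Derive (fun x : R => Y x) c = Y1 c),
      (is_derive_unique _ _ _ HY1 : Derive (fun x : R => Y1 x) c = Y2 c). field; lra.
  - assert (Hs : 0 < sin c) by (apply sin_gt_0; lra).
    assert (Hcos : 0 <= cos c) by (apply cos_ge_0; lra).
    assert (Hd : 2 * Y c * Y1 c + 2 * Y1 c * Y2 c / mu <= 0).
    { apply (Rmult_le_reg_l (sin c * mu)); [apply Rmult_lt_0_compat; lra|].
      replace (sin c * mu * (2 * Y c * Y1 c + 2 * Y1 c * Y2 c / mu))
        with (2 * Y1 c * (mu * sin c * Y c + sin c * Y2 c)) by (field; lra).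
      replace (mu * sin c * Y c + sin c * Y2 c) with (- (2 * lam * cos c * Y1 c))
        by (specialize (Hode c); lra).
      replace (2 * Y1 c * - (2 * lam * cos c * Y1 c))
        with (- (4 * (lam * cos c) * Y1 c ^ 2)) by ring.
      pose proof (Rmult_le_pos _ _ Hlam Hcos). pose proof (pow2_ge_0 (Y1 c)).
      pose proof (Rmult_le_pos _ _ H H0). lra. }
    nra.
Qed.

Lemma is_derive_geg_cos (lam : R) (k : nat) (p : R) :
  is_derive (fun q => gegenbauer lam k (cos q)) p (- sin p * dgeg lam k (cos p)).
Proof.
  apply (is_derive_comp (gegenbauer lam k) cos p (dgeg lam k (cos p)) (- sin p)).
  - apply is_derive_gegenbauer.
  - apply is_derive_Reals, derivable_pt_lim_cos.
Qed.

Lemma is_derive_dgeg_cos (lam : R) (k : nat) (p : R) :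
  is_derive (fun q => - sin q * dgeg lam k (cos q)) p
    (sin p ^ 2 * ddgeg lam k (cos p) - cos p * dgeg lam k (cos p)).
Proof.
  pose proof (is_derive_dgeg lam k (cos p)) as H.
  auto_derive; [eexists; exact H|].
  rewrite (is_derive_unique _ _ _ H : Derive (fun x : R => dgeg lam k x) (cos p) = _). ring.
Qed.

Lemma gegenbauer_ode_cos (lam : R) (k : nat) (p : R) :
  sin p * (sin p ^ 2 * ddgeg lam k (cos p) - cos p * dgeg lam k (cos p))
  + 2 * lam * cos p * (- sin p * dgeg lam k (cos p))
  + INR k * (INR k + 2 * lam) * sin p * gegenbauer lam k (cos p) = 0.
Proof.
  pose proof (gegenbauer_ode lam k (cos p)) as H.
  assert (Hs : sin p ^ 2 = 1 - cos p ^ 2).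
  { pose proof (sin2_cos2 p) as E. unfold Rsqr in E. lra. }
  rewrite Hs.
  transitivity (sin p * ((1 - cos p ^ 2) * ddgeg lam k (cos p)
    - (2 * lam + 1) * cos p * dgeg lam k (cos p)
    + INR k * (INR k + 2 * lam) * gegenbauer lam k (cos p))); [ring|].
  rewrite H; ring.
Qed.

Lemma gegenbauer_at_1_pos (lam : R) (k : nat) : 0 < lam -> 0 < gegenbauer lam k 1.
Proof.
  intros H. rewrite gegenbauer_at_1. apply Rdiv_lt_0_compat.
  - apply poch_pos; lra.
  - apply INR_fact_lt_0.
Qed.

Lemma acos_bound_pos (x : R) : 0 <= x <= 1 -> 0 <= acos x <= PI / 2.
Proof.
  intros Hx. pose proof (acos_bound x). split; [tauto|].
  destruct (Rle_dec (acos x) (PI / 2)) as [H1|H1]; [exact H1|].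
  pose proof PI_RGT_0.
  assert (cos (acos x) < 0) by (apply cos_lt_0; lra).
  rewrite cos_acos in H2; lra.
Qed.

(** The energy at angle 0 is [C_k(1)^2], because the angular derivative carries a factor [sin p].
    This settles [0 <= x <= 1], and parity gives the rest; degree 0 is apart because its eigenvalue
    vanishes. *)
Lemma gegenbauer_bound (lam : R) (k : nat) (x : R) :
  0 < lam -> -1 <= x <= 1 -> Rabs (gegenbauer lam k x) <= gegenbauer lam k 1.
Proof.
  intros Hlam Hx.
  assert (Hpos : forall x, 0 <= x <= 1 -> Rabs (gegenbauer lam k x) <= gegenbauer lam k 1).
  { clear x Hx; intros x Hx.
    destruct k as [|k]; [rewrite !gegenbauer_0, Rabs_R1; lra|].
    assert (Hmu : 0 < INR (S k) * (INR (S k) + 2 * lam)).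
    { pose proof (pos_INR k). rewrite S_INR. apply Rmult_lt_0_compat; lra. }
    assert (Hac : 0 <= acos x <= PI / 2).
    { apply acos_bound_pos; lra. }
    pose proof (energy_decreasing lam _ _ _ _ (Rlt_le _ _ Hlam) Hmu
      (is_derive_geg_cos lam (S k)) (is_derive_dgeg_cos lam (S k))
      (gegenbauer_ode_cos lam (S k)) _ Hac) as H.
    cbv beta in H. rewrite cos_acos, cos_0, sin_0 in H by lra.
    pose proof (gegenbauer_at_1_pos lam (S k) Hlam).
    rewrite <- (Rabs_pos_eq (gegenbauer lam (S k) 1)) by lra.
    apply Rsqr_le_abs_0. unfold Rsqr.
    assert (0 <= (- sin (acos x) * dgeg lam (S k) x) ^ 2
             / (INR (S k) * (INR (S k) + 2 * lam))).
    { apply Rdiv_le_0_compat; [apply pow2_ge_0|exact Hmu]. }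
    replace ((- 0 * dgeg lam (S k) 1) ^ 2 / (INR (S k) * (INR (S k) + 2 * lam)))
      with 0 in H by (unfold Rdiv; ring).
    lra. }
  destruct (Rle_dec 0 x) as [H0|H0]; [apply Hpos; lra|].
  rewrite <- (Ropp_involutive x), gegenbauer_opp, Rabs_mult, pow_1_abs, Rmult_1_l.
  apply Hpos; lra.
Qed.

(** * The generating function *)

(** The weight [INR k + 2 * lam] is the one in the remainder of [gegenbauer_partial_ode];
    summability makes that remainder tend to 0. The ratio of consecutive terms is
    [rho + 2 lam rho / (k+1)]. *)
Lemma ex_series_gegenbauer_at_1_weighted (lam rho : R) : 0 < lam -> 0 < rho < 1 ->
  ex_series (fun k => (INR k + 2 * lam) * gegenbauer lam k 1 * rho ^ k).
Proof.
  intros Hlam Hrho. apply ex_series_Rabs.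
  assert (Hpos : forall k, 0 < (INR k + 2 * lam) * gegenbauer lam k 1 * rho ^ k).
  { intros k. pose proof (pos_INR k). pose proof (gegenbauer_at_1_pos lam k Hlam).
    repeat apply Rmult_lt_0_compat; try lra. apply pow_lt; lra. }
  apply (ex_series_DAlembert _ rho); [lra| |].
  - intros k. apply Rgt_not_eq, Hpos.
  - apply (is_lim_seq_ext (fun k => rho + 2 * lam * rho * / (INR k + 1))).
    + intros k. rewrite Rabs_pos_eq by (apply Rlt_le, Rdiv_lt_0_compat; apply Hpos).
      rewrite !gegenbauer_at_1. simpl poch. rewrite INR_fact_S, S_INR. simpl pow.
      pose proof (pos_INR k). pose proof (poch_pos (2 * lam) k).
      field. repeat split; auto using fact_ne; try lra.
      * apply pow_nonzero; lra.
    + replace (Finite rho) with (Finite (rho + 2 * lam * rho * 0)) by (f_equal; ring).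
      apply is_lim_seq_plus'; [apply is_lim_seq_const|].
      apply is_lim_seq_mult'; [apply is_lim_seq_const|].
      apply (is_lim_seq_inv (fun k => INR k + 1) p_infty); [|discriminate].
      apply (is_lim_seq_plus _ _ p_infty 1 p_infty);
        [apply is_lim_seq_INR|apply is_lim_seq_const|reflexivity].
Qed.

Lemma ex_series_gegenbauer_at_1 (lam rho : R) : 0 < lam -> 0 < rho < 1 ->
  ex_series (fun k => gegenbauer lam k 1 * rho ^ k).
Proof.
  intros Hlam Hrho.
  apply (ex_series_le (K := R_AbsRing) (V := R_CompleteNormedModule) _
    (fun k => / (2 * lam) * ((INR k + 2 * lam) * gegenbauer lam k 1 * rho ^ k))).
  - intros k. pose proof (pos_INR k).
    assert (Hp : 0 < gegenbauer lam k 1 * rho ^ k).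
    { apply Rmult_lt_0_compat; [apply gegenbauer_at_1_pos, Hlam|apply pow_lt; lra]. }
    change (Rabs (gegenbauer lam k 1 * rho ^ k)
      <= / (2 * lam) * ((INR k + 2 * lam) * gegenbauer lam k 1 * rho ^ k)).
    rewrite Rabs_pos_eq by lra.
    apply (Rmult_le_reg_l (2 * lam)); [lra|].
    replace (2 * lam * (/ (2 * lam) * ((INR k + 2 * lam) * gegenbauer lam k 1 * rho ^ k)))
      with ((INR k + 2 * lam) * (gegenbauer lam k 1 * rho ^ k)) by (field; lra).
    nra.
  - apply (ex_series_scal (V := R_NormedModule)), ex_series_gegenbauer_at_1_weighted; auto.
Qed.

(** The full generating function solves [Q g' = 2 lam (x - r) g]. For a partial sum the recurrence
    makes everything telescope except two terms at the cut. *)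
Lemma gegenbauer_partial_ode (lam x r : R) (N : nat) :
  (1 - 2 * x * r + r ^ 2)
    * sum_f_R0 (fun k => gegenbauer lam k x * (INR k * r ^ pred k)) N
  - 2 * lam * (x - r) * sum_f_R0 (fun k => gegenbauer lam k x * r ^ k) N
  = r ^ N * (- (INR N + 1) * gegenbauer lam (N + 1) x
             + (INR N + 2 * lam) * r * gegenbauer lam N x).
Proof.
  induction N as [|N IH].
  - simpl sum_f_R0. simpl Nat.add. rewrite gegenbauer_0, gegenbauer_1. simpl; ring.
  - rewrite !tech5. simpl pred.
    replace (S N + 1)%nat with (N + 2)%nat by lia.
    pose proof (gegenbauer_rec lam N x) as H.
    replace (N + 1)%nat with (S N) in * by lia.
    rewrite S_INR. replace (- (INR N + 1 + 1) * gegenbauer lam (N + 2) x)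
      with (- ((INR N + 2) * gegenbauer lam (N + 2) x)) by ring.
    rewrite H. simpl pow in *.
    match goal with |- ?a * (?b + ?c) - ?d * (?e + ?f) = _ =>
      replace (a * (b + c) - d * (e + f)) with ((a * b - d * e) + (a * c - d * f)) by ring end.
    rewrite IH. ring.
Qed.

Lemma one_sub_two_mul_add_sq_bounds (x r rho : R) :
  -1 <= x <= 1 -> 0 <= r <= rho -> rho < 1 ->
  (1 - rho) ^ 2 <= 1 - 2 * x * r + r ^ 2 <= 4.
Proof. intros; split; nra. Qed.

(** Uniformity in [x] is what allows the expansion to be averaged later. With the integrating factor
    [Q^lam], the derivative in [r] of [g Q^lam] is [Q^(lam-1)] times the remainder of
    [gegenbauer_partial_ode], and the mean value theorem on [[0, rho]] finishes. *)
Lemma gegenbauer_generating_uniform (lam rho : R) : 0 < lam -> 0 < rho < 1 ->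
  exists e : nat -> R, is_lim_seq e 0 /\ forall x N, -1 <= x <= 1 ->
    Rabs (sum_f_R0 (fun k => gegenbauer lam k x * rho ^ k) N
          - Rpower (1 - 2 * x * rho + rho ^ 2) (- lam)) <= e N.
Proof.
  intros Hlam Hrho.
  (* The factors bound, in order, [Q(rho)^(-lam)], then [Q(c)^lam / Q(c)] at the mean value point,
     the number of summands in the remainder, and the length of [[0, rho]]. *)
  set (M := / Rpower ((1 - rho) ^ 2) lam * (Rpower 4 lam * / (1 - rho) ^ 2) * 2 * rho).
  exists (fun N => M * ((INR N + 2 * lam) * gegenbauer lam N 1 * rho ^ N)).
  split.
  { replace (Finite 0) with (Finite (M * 0)) by (f_equal; ring).
    apply is_lim_seq_mult'; [apply is_lim_seq_const|].
    apply ex_series_lim_0, ex_series_gegenbauer_at_1_weighted; auto. }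
  intros x N Hx.
  set (Q := fun r => 1 - 2 * x * r + r ^ 2).
  set (g := fun r => sum_f_R0 (fun k => gegenbauer lam k x * r ^ k) N).
  set (g1 := fun r => sum_f_R0 (fun k => gegenbauer lam k x * (INR k * r ^ pred k)) N).
  assert (H1 : 0 < (1 - rho) ^ 2) by (apply pow_lt; lra).
  assert (HQ : forall r, 0 <= r <= rho -> (1 - rho) ^ 2 <= Q r <= 4).
  { intros r Hr. apply one_sub_two_mul_add_sq_bounds; lra. }
  assert (Hg : forall r, is_derive g r (g1 r)).
  { intros r. apply (is_derive_sum_f_R0 (fun k r => gegenbauer lam k x * r ^ k)
      (fun k r => gegenbauer lam k x * (INR k * r ^ pred k))).
    intros k. apply (is_derive_scal (fun r => r ^ k)).
    auto_derive; [exact I|ring]. }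
  set (bd := fun r => r ^ N * (- (INR N + 1) * gegenbauer lam (N + 1) x
             + (INR N + 2 * lam) * r * gegenbauer lam N x)).
  destruct (MVT_cor2 (fun r => g r * Rpower (Q r) lam)
    (fun r => Rpower (Q r) lam * / Q r * bd r) 0 rho) as [c [Hc Hc0]]; [lra| |].
  { intros c Hc. apply is_derive_Reals.
    pose proof (HQ c Hc) as HQc.
    pose proof (gegenbauer_partial_ode lam x c N) as Hode.
    fold (Q c) in Hode. change (Q c * g1 c - 2 * lam * (x - c) * g c = bd c) in Hode.
    rewrite <- Hode. unfold Rpower, Q at 1 2.
    specialize (Hg c).
    auto_derive; [repeat split; [eexists; exact Hg|fold (Q c); unfold Q in *; lra]|].
    rewrite (is_derive_unique _ _ _ Hg : Derive (fun x : R => g x) c = _).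
    replace (1 + - (2 * x * c) + c * (c * 1)) with (Q c) by (unfold Q; ring).
    unfold Q; field. fold (Q c). lra. }
  cbv beta in Hc.
  replace (g 0) with 1 in Hc.
  2:{ unfold g. clear. induction N as [|N IH]; simpl sum_f_R0.
      - rewrite gegenbauer_0; simpl; ring.
      - rewrite <- IH. simpl; ring. }
  replace (Rpower (Q 0) lam) with 1 in Hc.
  2:{ unfold Q. replace (1 - 2 * x * 0 + 0 ^ 2) with 1 by ring.
      unfold Rpower. rewrite ln_1, Rmult_0_r, exp_0. reflexivity. }
  assert (HQr := HQ rho ltac:(lra)). assert (HQc := HQ c ltac:(lra)).
  fold (g rho). fold (Q rho).
  assert (HP : 0 < Rpower (Q rho) lam) by apply exp_pos.
  replace (g rho - Rpower (Q rho) (- lam))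
    with (/ Rpower (Q rho) lam * (g rho * Rpower (Q rho) lam - 1 * 1)).
  2:{ rewrite Rpower_Ropp. field. lra. }
  rewrite Hc, !Rabs_mult, Rminus_0_r, (Rabs_pos_eq rho) by lra.
  assert (Hbd : Rabs (bd c) <= 2 * ((INR N + 2 * lam) * gegenbauer lam N 1 * rho ^ N)).
  { unfold bd. rewrite Rabs_mult.
    (* By this relation both summands of the remainder have the same bound. *)
    assert (E : (INR N + 1) * gegenbauer lam (N + 1) 1
                = (INR N + 2 * lam) * gegenbauer lam N 1).
    { rewrite !gegenbauer_at_1. replace (N + 1)%nat with (S N) by lia.
      rewrite INR_fact_S. simpl poch. pose proof (pos_INR N). field.
      split; [apply fact_ne|lra]. }
    pose proof (pos_INR N).
    pose proof (gegenbauer_bound lam N x Hlam Hx) as B1.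
    pose proof (gegenbauer_bound lam (N + 1) x Hlam Hx) as B2.
    pose proof (gegenbauer_at_1_pos lam N Hlam).
    replace (2 * ((INR N + 2 * lam) * gegenbauer lam N 1 * rho ^ N))
      with (rho ^ N * (2 * ((INR N + 2 * lam) * gegenbauer lam N 1))) by ring.
    apply Rmult_le_compat; try apply Rabs_pos.
    - rewrite <- RPow_abs, (Rabs_pos_eq c) by lra. apply pow_incr; lra.
    - eapply Rle_trans; [apply Rabs_triang|].
      rewrite !Rabs_mult, Rabs_Ropp, (Rabs_pos_eq (INR N + 1)),
        (Rabs_pos_eq (INR N + 2 * lam)), (Rabs_pos_eq c) by lra.
      assert ((INR N + 1) * Rabs (gegenbauer lam (N + 1) x)
              <= (INR N + 1) * gegenbauer lam (N + 1) 1)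
        by (apply Rmult_le_compat_l; lra).
      assert (c * Rabs (gegenbauer lam N x) <= 1 * gegenbauer lam N 1).
      { apply Rmult_le_compat; try lra. apply Rabs_pos. }
      assert ((INR N + 2 * lam) * (c * Rabs (gegenbauer lam N x))
              <= (INR N + 2 * lam) * (1 * gegenbauer lam N 1))
        by (apply Rmult_le_compat_l; lra).
      lra. }
  assert (HA : Rabs (/ Rpower (Q rho) lam) <= / Rpower ((1 - rho) ^ 2) lam).
  { rewrite Rabs_pos_eq by (left; apply Rinv_0_lt_compat, HP).
    apply Rinv_le_contravar; [apply exp_pos|]. apply Rle_Rpower_l; lra. }
  assert (HB : Rabs (Rpower (Q c) lam) * Rabs (/ Q c) <= Rpower 4 lam * / (1 - rho) ^ 2).
  { rewrite (Rabs_pos_eq (Rpower _ _)) by (left; apply exp_pos).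
    rewrite Rabs_pos_eq by (left; apply Rinv_0_lt_compat; lra).
    apply Rmult_le_compat.
    - left; apply exp_pos.
    - left; apply Rinv_0_lt_compat; lra.
    - apply Rle_Rpower_l; lra.
    - apply Rinv_le_contravar; lra. }
  unfold M.
  set (z := (INR N + 2 * lam) * gegenbauer lam N 1 * rho ^ N) in *.
  replace (/ Rpower ((1 - rho) ^ 2) lam * (Rpower 4 lam * / (1 - rho) ^ 2) * 2 * rho * z)
    with (/ Rpower ((1 - rho) ^ 2) lam * (Rpower 4 lam * / (1 - rho) ^ 2 * (2 * z) * rho))
    by ring.
  apply Rmult_le_compat; [apply Rabs_pos| |exact HA|].
  - apply Rmult_le_pos; [|lra]. repeat apply Rmult_le_pos; apply Rabs_pos.
  - apply Rmult_le_compat_r; [lra|].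
    apply Rmult_le_compat; try apply Rabs_pos; [|exact HB|exact Hbd].
    apply Rmult_le_pos; apply Rabs_pos.
Qed.

(** * Averages against powers of the sine *)

(* In the variable [v = cos th] this is integration against [(1 - v^2)^((m-1)/2)] on [[-1,1]]. *)
Definition cint (m : nat) (g : R -> R) : R :=
  RInt (fun th => g (cos th) * sin th ^ m) 0 PI.

Lemma ex_RInt_cint (m : nat) (g : R -> R) :
  (forall v, -1 <= v <= 1 -> continuous g v) ->
  ex_RInt (fun th => g (cos th) * sin th ^ m) 0 PI.
Proof.
  intros Hg. apply (ex_RInt_continuous (V := R_CompleteNormedModule)). intros z _.
  apply (continuous_mult (fun th => g (cos th)) (fun th => sin th ^ m)).
  - apply (continuous_comp cos g); [apply continuous_cos|apply Hg, COS_bound].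
  - apply (ex_derive_continuous (fun th => sin th ^ m)). auto_derive; exact I.
Qed.

Lemma cint_ext (m : nat) (f g : R -> R) :
  (forall v, -1 <= v <= 1 -> f v = g v) -> cint m f = cint m g.
Proof.
  intros H. apply RInt_ext. intros x _. rewrite H; [reflexivity|apply COS_bound].
Qed.

Lemma cint_scal (m : nat) (c : R) (g : R -> R) :
  (forall v, -1 <= v <= 1 -> continuous g v) ->
  cint m (fun v => c * g v) = c * cint m g.
Proof.
  intros H. unfold cint.
  rewrite <- (RInt_scal (V := R_CompleteNormedModule)) by (apply ex_RInt_cint, H).
  apply RInt_ext; intros. unfold scal; simpl; unfold mult; simpl. ring.
Qed.

Lemma cint_plus (m : nat) (f g : R -> R) :
  (forall v, -1 <= v <= 1 -> continuous f v) ->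
  (forall v, -1 <= v <= 1 -> continuous g v) ->
  cint m (fun v => f v + g v) = cint m f + cint m g.
Proof.
  intros Hf Hg. unfold cint.
  transitivity (plus (RInt (fun th => f (cos th) * sin th ^ m) 0 PI)
     (RInt (fun th => g (cos th) * sin th ^ m) 0 PI)); [|reflexivity].
  rewrite <- (RInt_plus (V := R_CompleteNormedModule)) by (apply ex_RInt_cint; assumption).
  apply RInt_ext; intros. unfold plus; simpl. ring.
Qed.

Lemma cint_le (m : nat) (f g : R -> R) :
  (forall v, -1 <= v <= 1 -> continuous f v) ->
  (forall v, -1 <= v <= 1 -> continuous g v) ->
  (forall v, -1 <= v <= 1 -> f v <= g v) -> cint m f <= cint m g.
Proof.
  intros Hf Hg H. apply RInt_le.
  - left; apply PI_RGT_0.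
  - apply ex_RInt_cint, Hf.
  - apply ex_RInt_cint, Hg.
  - intros x Hx. apply Rmult_le_compat_r.
    + apply pow_le, sin_ge_0; lra.
    + apply H, COS_bound.
Qed.

Lemma cint_gt_0 (m : nat) (g : R -> R) :
  (forall v, -1 <= v <= 1 -> continuous g v) ->
  (forall v, -1 <= v <= 1 -> 0 < g v) -> 0 < cint m g.
Proof.
  intros Hg H. apply RInt_gt_0.
  - apply PI_RGT_0.
  - intros x Hx. apply Rmult_lt_0_compat; [apply H, COS_bound|].
    apply pow_lt, sin_gt_0; lra.
  - intros z _.
    apply (continuous_mult (fun th => g (cos th)) (fun th => sin th ^ m)).
    + apply (continuous_comp cos g); [apply continuous_cos|apply Hg, COS_bound].
    + apply (ex_derive_continuous (fun th => sin th ^ m)). auto_derive; exact I.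
Qed.

(** Raising [m] by 2 raises [lam = (m+1)/2] by 1, so averages at the level [lam + 1] can be
    expressed at the level [lam]. *)
Lemma cint_SS (m : nat) (g : R -> R) : cint (m + 2) g = cint m (fun v => (1 - v ^ 2) * g v).
Proof.
  apply RInt_ext. intros x _. rewrite pow_add.
  pose proof (sin2_cos2 x) as E; unfold Rsqr in E.
  replace (sin x ^ 2) with (1 - cos x ^ 2) by (simpl; lra).
  match goal with |- @eq _ ?a ?b => change (@eq R a b) end. ring.
Qed.

(** The fundamental theorem for [sin th ^ S m * g (cos th)], which vanishes at both ends. *)
Lemma cint_by_parts (m : nat) (g g1 : R -> R) :
  (forall v, -1 <= v <= 1 -> is_derive g v (g1 v)) ->
  (forall v, -1 <= v <= 1 -> continuous g1 v) ->
  (INR m + 1) * cint m (fun v => v * g v) = cint m (fun v => (1 - v ^ 2) * g1 v).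
Proof.
  intros Hd Hc.
  assert (Hg : forall v, -1 <= v <= 1 -> continuous g v).
  { intros v Hv. apply (ex_derive_continuous g). eexists; apply Hd, Hv. }
  assert (Hvg : forall v, -1 <= v <= 1 -> continuous (fun v => v * g v) v).
  { intros v Hv. apply (continuous_mult (fun v => v) g); [apply continuous_id|auto]. }
  assert (Hw : forall v, -1 <= v <= 1 -> continuous (fun v => (1 - v ^ 2) * g1 v) v).
  { intros v Hv. apply (continuous_mult (fun v => 1 - v ^ 2) g1); [|auto].
    apply (ex_derive_continuous (fun v => 1 - v ^ 2)). auto_derive; exact I. }
  enough (E : cint m (fun v => (INR m + 1) * (v * g v) + (-1) * ((1 - v ^ 2) * g1 v)) = 0).
  { rewrite cint_plus, !cint_scal in E; auto.
    - lra.
    - intros; apply (continuous_scal_r (K := R_AbsRing) (V := R_NormedModule)); auto.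
    - intros; apply (continuous_scal_r (K := R_AbsRing) (V := R_NormedModule)); auto. }
  apply is_RInt_unique.
  replace 0 with (minus (sin PI ^ S m * g (cos PI)) (sin 0 ^ S m * g (cos 0))) at 2.
  2:{ rewrite sin_PI, sin_0. unfold minus, plus, opp; simpl. ring. }
  apply (is_RInt_derive (V := R_CompleteNormedModule) (fun th => sin th ^ S m * g (cos th))).
  - intros x _.
    assert (Hx := Hd (cos x) (COS_bound x)).
    pose proof (sin2_cos2 x) as E; unfold Rsqr in E.
    assert (Hp : is_derive (fun th => sin th ^ S m) x ((INR m + 1) * cos x * sin x ^ m)).
    { rewrite <- S_INR. auto_derive; [exact I|]. simpl; ring. }
    assert (Hgc : is_derive (fun th => g (cos th)) x (- sin x * g1 (cos x))).
    { apply (is_derive_comp g cos); [exact Hx|apply is_derive_Reals, derivable_pt_lim_cos]. }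
    pose proof (is_derive_mult (K := R_AbsRing) _ _ _ _ _ Hp Hgc Rmult_comm) as H.
    unfold plus, mult in H; simpl in H.
    replace (((INR m + 1) * (cos x * g (cos x)) + -1 * ((1 - cos x ^ 2) * g1 (cos x))) * sin x ^ m)
      with ((INR m + 1) * cos x * sin x ^ m * g (cos x)
            + sin x * sin x ^ m * (- sin x * g1 (cos x))); [exact H|].
    replace (1 - cos x ^ 2) with (sin x * sin x) by (simpl; lra). ring.
  - intros z _.
    apply (continuous_mult (fun th => _) (fun th => sin th ^ m)).
    + apply (continuous_comp cos
        (fun v => (INR m + 1) * (v * g v) + -1 * ((1 - v ^ 2) * g1 v)));
        [apply continuous_cos|].
      pose proof (COS_bound z).
      apply (continuous_plus (K := R_AbsRing) (V := R_NormedModule)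
        (fun v => (INR m + 1) * (v * g v)) (fun v => -1 * ((1 - v ^ 2) * g1 v)));
      apply (continuous_scal_r (K := R_AbsRing) (V := R_NormedModule)); auto.
    + apply (ex_derive_continuous (fun th => sin th ^ m)). auto_derive; exact I.
Qed.

Lemma continuity_2d_pt_comp_cos (f : R -> R -> R) (x t : R) :
  continuity_2d_pt f x (cos t) -> continuity_2d_pt (fun u v => f u (cos v)) x t.
Proof.
  intros Hf eps. destruct (Hf eps) as [d Hd].
  assert (Hc : continuity_2d_pt (fun _ v => cos v) x t).
  { apply (continuity_1d_2d_pt_comp cos (fun _ v => v));
      [apply continuity_cos|apply continuity_2d_pt_id2]. }
  destruct (Hc d) as [d' Hd'].
  assert (Hm : 0 < Rmin d d') by (apply Rmin_pos; apply cond_pos).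
  exists (mkposreal _ Hm); simpl. intros u v Hu Hv. apply Hd.
  - eapply Rlt_le_trans; [exact Hu|apply Rmin_l].
  - apply (Hd' u); eapply Rlt_le_trans; eauto; apply Rmin_r.
Qed.

Lemma is_derive_cint (m : nat) (f fx : R -> R -> R) (x0 : R) :
  locally x0 (fun x => forall v, -1 <= v <= 1 -> is_derive (fun u => f u v) x (fx x v)) ->
  (forall v, -1 <= v <= 1 -> continuity_2d_pt fx x0 v) ->
  locally x0 (fun x => forall v, -1 <= v <= 1 -> continuous (f x) v) ->
  is_derive (fun x => cint m (f x)) x0 (cint m (fx x0)).
Proof.
  intros Hd Hc Hf.
  assert (Hd' : locally x0 (fun x => forall t,
     is_derive (fun u => f u (cos t) * sin t ^ m) x (fx x (cos t) * sin t ^ m))).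
  { revert Hd. apply filter_imp. intros x Hx t.
    specialize (Hx (cos t) (COS_bound t)).
    pose proof (is_derive_scal (fun u => f u (cos t)) x (sin t ^ m) _ Hx) as H.
    apply (is_derive_ext (fun u => sin t ^ m * f u (cos t))); [intros; apply Rmult_comm|].
    replace (fx x (cos t) * sin t ^ m) with (sin t ^ m * fx x (cos t)) by ring. exact H. }
  unfold cint.
  replace (RInt (fun th => fx x0 (cos th) * sin th ^ m) 0 PI)
    with (RInt (fun t => Derive (fun u => f u (cos t) * sin t ^ m) x0) 0 PI).
  2:{ apply RInt_ext. intros t _. apply is_derive_unique.
      apply locally_singleton in Hd'. apply Hd'. }
  apply (is_derive_RInt_param (fun x t => f x (cos t) * sin t ^ m)).
  - revert Hd'. apply filter_imp. intros x Hx t _. eexists; apply Hx.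
  - intros t _.
    apply (continuity_2d_pt_ext_loc (fun u v => fx u (cos v) * sin v ^ m)).
    + destruct Hd' as [d Hd']. exists d. intros u v Hu _. symmetry.
      apply is_derive_unique, Hd'. exact Hu.
    + apply (continuity_2d_pt_mult (fun u v => fx u (cos v)) (fun _ v => sin v ^ m)).
      * apply continuity_2d_pt_comp_cos, Hc, COS_bound.
      * apply (continuity_1d_2d_pt_comp (fun v => sin v ^ m) (fun _ v => v));
          [|apply continuity_2d_pt_id2].
        apply continuity_pt_filterlim.
        apply (ex_derive_continuous (fun th => sin th ^ m)). auto_derive; exact I.
  - revert Hf. apply filter_imp. intros x Hx. apply ex_RInt_cint, Hx.
Qed.

(** * The product formula and the kernel *)

Lemma continuous_gegenbauer (lam : R) (k : nat) (x : R) : continuous (gegenbauer lam k) x.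
Proof.
  apply (ex_derive_continuous (gegenbauer lam k)). eexists; apply is_derive_gegenbauer.
Qed.

Lemma continuous_dgeg (lam : R) (k : nat) (x : R) : continuous (dgeg lam k) x.
Proof. apply (ex_derive_continuous (dgeg lam k)). eexists; apply is_derive_dgeg. Qed.

Lemma continuous_ddgeg (lam : R) (k : nat) (x : R) : continuous (ddgeg lam k) x.
Proof.
  destruct k as [|k]; simpl; [apply continuous_const|].
  apply (continuous_scal_r (K := R_AbsRing) (V := R_NormedModule)), continuous_dgeg.
Qed.

Ltac cont2d :=
  repeat first
    [ apply continuity_2d_pt_plus | apply continuity_2d_pt_minus | apply continuity_2d_pt_mult
    | apply continuity_2d_pt_opp | apply continuity_2d_pt_id1 | apply continuity_2d_pt_id2
    | apply continuity_2d_pt_const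
    | apply (continuity_1d_2d_pt_comp cos); [apply continuity_cos|]
    | apply (continuity_1d_2d_pt_comp sin); [apply continuity_sin|] ].

Lemma continuous_Rplus (f g : R -> R) (x : R) :
  continuous f x -> continuous g x -> continuous (fun y => f y + g y) x.
Proof. apply (continuous_plus (K := R_AbsRing) (V := R_NormedModule)). Qed.

Lemma continuous_Rminus (f g : R -> R) (x : R) :
  continuous f x -> continuous g x -> continuous (fun y => f y - g y) x.
Proof. apply (continuous_minus (K := R_AbsRing) (V := R_NormedModule)). Qed.

Lemma continuous_Rmult (f g : R -> R) (x : R) :
  continuous f x -> continuous g x -> continuous (fun y => f y * g y) x.
Proof. apply (continuous_mult (K := R_AbsRing)). Qed.

Ltac cont1d := cbv beta; lazymatch goal with
  | |- continuous (fun _ => ?c) _ => apply continuous_const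
  | |- continuous (fun v => v) _ => apply continuous_id
  | |- continuous (fun v => @?f v + @?g v) _ => apply (continuous_Rplus f g); cont1d
  | |- continuous (fun v => @?f v - @?g v) _ => apply (continuous_Rminus f g); cont1d
  | |- continuous (fun v => @?f v * @?g v) _ => apply (continuous_Rmult f g); cont1d
  | |- continuous (fun v => gegenbauer ?l ?k (@?f v)) _ =>
      apply (continuous_comp f (gegenbauer l k)); [cont1d|apply continuous_gegenbauer]
  | |- continuous (fun v => dgeg ?l ?k (@?f v)) _ =>
      apply (continuous_comp f (dgeg l k)); [cont1d|apply continuous_dgeg]
  | |- continuous (fun v => ddgeg ?l ?k (@?f v)) _ =>
      apply (continuous_comp f (ddgeg l k)); [cont1d|apply continuous_ddgeg]
  | _ => idtac
  end.

Section Product.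
Variables (m k : nat) (s sg : R).
Hypothesis Hsg : s ^ 2 + sg ^ 2 = 1.
Let lam := (INR m + 1) / 2.
(** The spherical cosine law: if [s] and [sg] are the cosine and sine of a polar distance, then
    [z p v] is the cosine of the distance between points at that distance and at distance [p] from
    the pole, [v] being the cosine of the angle between the two arcs. *)
Let z (p v : R) := s * cos p + sg * sin p * v.
Let zp (p v : R) := - s * sin p + sg * cos p * v.
Let Phi (p : R) := cint m (fun v => gegenbauer lam k (z p v)).
Let Phi1 (p : R) := cint m (fun v => dgeg lam k (z p v) * zp p v).
Let Phi2 (p : R) :=
  cint m (fun v => ddgeg lam k (z p v) * (zp p v * zp p v) - dgeg lam k (z p v) * z p v).

Lemma is_derive_arc (p v : R) : is_derive (fun q => z q v) p (zp p v).
Proof. unfold z, zp. auto_derive; [exact I|ring]. Qed.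

Lemma is_derive_arc1 (p v : R) : is_derive (fun q => zp q v) p (- z p v).
Proof. unfold z, zp. auto_derive; [exact I|ring]. Qed.

Lemma is_derive_arc_average (p : R) : is_derive Phi p (Phi1 p).
Proof.
  apply (is_derive_cint m (fun p v => gegenbauer lam k (z p v))
    (fun p v => dgeg lam k (z p v) * zp p v)).
  - apply filter_forall. intros x v _.
    replace (dgeg lam k (z x v) * zp x v) with (scal (zp x v) (dgeg lam k (z x v)))
      by (unfold scal; simpl; unfold mult; simpl; ring).
    apply (is_derive_comp (gegenbauer lam k) (fun q => z q v));
      [apply is_derive_gegenbauer|apply is_derive_arc].
  - intros v _. apply continuity_2d_pt_mult; [|unfold zp; cont2d].
    apply (continuity_1d_2d_pt_comp (dgeg lam k)); [|unfold z; cont2d].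
    apply continuity_pt_filterlim, continuous_dgeg.
  - apply filter_forall. intros x v _. unfold z. cont1d.
Qed.

Lemma is_derive_arc_average1 (p : R) : is_derive Phi1 p (Phi2 p).
Proof.
  apply (is_derive_cint m (fun p v => dgeg lam k (z p v) * zp p v)
    (fun p v => ddgeg lam k (z p v) * (zp p v * zp p v) - dgeg lam k (z p v) * z p v)).
  - apply filter_forall. intros x v _.
    assert (H : is_derive (fun q => dgeg lam k (z q v)) x (zp x v * ddgeg lam k (z x v))).
    { apply (is_derive_comp (dgeg lam k) (fun q => z q v));
        [apply is_derive_dgeg|apply is_derive_arc]. }
    pose proof (is_derive_mult (K := R_AbsRing) _ _ _ _ _ H (is_derive_arc1 x v) Rmult_comm)
      as H'. unfold plus, mult in H'; simpl in H'.
    replace (ddgeg lam k (z x v) * (zp x v * zp x v) - dgeg lam k (z x v) * z x v)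
      with (zp x v * ddgeg lam k (z x v) * zp x v + dgeg lam k (z x v) * - z x v) by ring.
    exact H'.
  - intros v _. apply continuity_2d_pt_minus; apply continuity_2d_pt_mult;
      try (unfold zp, z; cont2d; fail).
    + apply (continuity_1d_2d_pt_comp (ddgeg lam k)); [|unfold z; cont2d].
      apply continuity_pt_filterlim, continuous_ddgeg.
    + apply (continuity_1d_2d_pt_comp (dgeg lam k)); [|unfold z; cont2d].
      apply continuity_pt_filterlim, continuous_dgeg.
  - apply filter_forall. intros x v _. unfold z, zp. cont1d.
Qed.

(** The average solves the equation of [gegenbauer lam k (cos p)]. Insert the Gegenbauer equation at
    [z] under the integral; by [zp^2 + z^2 = 1 - sg^2 (1 - v^2)] and [sin p z + cos p zp = sg v],
    the integrand that remains is [sg] times the difference of the two sides of [cint_by_parts]. *)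
Lemma arc_average_ode (p : R) :
  sin p * Phi2 p + 2 * lam * cos p * Phi1 p
  + INR k * (INR k + 2 * lam) * sin p * Phi p = 0.
Proof.
  unfold Phi, Phi1, Phi2.
  rewrite <- !cint_scal, <- !cint_plus by (intros; unfold z, zp; cont1d).
  pose proof (cint_by_parts m (fun v => dgeg lam k (z p v))
    (fun v => sg * sin p * ddgeg lam k (z p v))) as H.
  assert (H1 : forall v, -1 <= v <= 1 -> is_derive (fun v => dgeg lam k (z p v)) v
     (sg * sin p * ddgeg lam k (z p v))).
  { intros v _. apply (is_derive_comp (dgeg lam k) (fun v => z p v));
      [apply is_derive_dgeg|]. unfold z. auto_derive; [exact I|ring]. }
  specialize (H H1 ltac:(intros; unfold z; cont1d)).
  transitivity (cint m (fun v => sg * (INR m + 1) * (v * dgeg lam k (z p v))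
    + (- sg) * ((1 - v ^ 2) * (sg * sin p * ddgeg lam k (z p v))))).
  - apply cint_ext. intros v _.
    pose proof (gegenbauer_ode lam k (z p v)) as O.
    pose proof (sin2_cos2 p) as E; unfold Rsqr in E.
    set (C := gegenbauer lam k (z p v)) in *. set (C1 := dgeg lam k (z p v)) in *.
    set (C2 := ddgeg lam k (z p v)) in *.
    replace (INR k * (INR k + 2 * lam) * sin p * C)
      with (sin p * (INR k * (INR k + 2 * lam) * C)) by ring.
    replace (INR k * (INR k + 2 * lam) * C)
      with ((2 * lam + 1) * z p v * C1 - (1 - z p v ^ 2) * C2) by lra.
    assert (E1 : zp p v * zp p v + z p v ^ 2 = 1 - sg ^ 2 * (1 - v ^ 2)).
    { unfold z, zp.
      transitivity ((s ^ 2 + sg ^ 2 * v ^ 2) * (sin p * sin p + cos p * cos p)); [ring|].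
      rewrite E. replace (s ^ 2) with (1 - sg ^ 2) by lra. ring. }
    assert (E2 : sin p * z p v + cos p * zp p v = sg * v).
    { unfold z, zp. transitivity (sg * v * (sin p * sin p + cos p * cos p)); [ring|].
      rewrite E; ring. }
    transitivity (sin p * C2 * (zp p v * zp p v + z p v ^ 2 - 1)
      + 2 * lam * C1 * (sin p * z p v + cos p * zp p v)); [ring|].
    rewrite E1, E2. unfold lam. field.
  - rewrite cint_plus, !cint_scal by (intros; unfold z; simpl; cont1d).
    rewrite Rmult_assoc, H. ring.
Qed.

(** Uniqueness: the difference of the two sides solves the equation and has zero energy at [p = 0],
    hence zero energy up to [PI / 2]. *)
Lemma arc_average_eq (p : R) : 0 <= p <= PI / 2 ->
  Phi p = cint m (fun _ => 1) * gegenbauer lam k s * gegenbauer lam k (cos p)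
          / gegenbauer lam k 1.
Proof.
  intros Hp.
  assert (Hlam : 0 < lam) by apply half_succ_pos.
  pose proof (gegenbauer_at_1_pos lam k Hlam) as H1.
  destruct (Nat.eq_dec k 0) as [Hk|Hk].
  { unfold Phi. rewrite Hk, !gegenbauer_0.
    rewrite (cint_ext m _ (fun _ => 1)) by (intros; apply gegenbauer_0). field. }
  assert (Hmu : 0 < INR k * (INR k + 2 * lam)).
  { assert (0 < INR k) by (apply lt_0_INR; lia). apply Rmult_lt_0_compat; lra. }
  set (c := cint m (fun _ => 1) * gegenbauer lam k s / gegenbauer lam k 1).
  set (Y := fun q => Phi q - c * gegenbauer lam k (cos q)).
  set (Y1 := fun q => Phi1 q - c * (- sin q * dgeg lam k (cos q))).
  set (Y2 := fun q => Phi2 q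
     - c * (sin q ^ 2 * ddgeg lam k (cos q) - cos q * dgeg lam k (cos q))).
  assert (HO : forall q, sin q * Y2 q + 2 * lam * cos q * Y1 q
     + INR k * (INR k + 2 * lam) * sin q * Y q = 0).
  { intros q. unfold Y, Y1, Y2. pose proof (arc_average_ode q) as A.
    pose proof (gegenbauer_ode_cos lam k q) as B.
    match type of A with ?a = 0 => match type of B with ?b = 0 =>
      transitivity (a - c * b); [ring|rewrite A, B; ring] end end. }
  assert (HE := energy_decreasing lam _ Y Y1 Y2 (Rlt_le _ _ Hlam) Hmu).
  specialize (HE ltac:(intros q; apply (is_derive_minus (K := R_AbsRing) (V := R_NormedModule)
    Phi); [apply is_derive_arc_average|apply is_derive_scal, is_derive_geg_cos])).
  specialize (HE ltac:(intros q; apply (is_derive_minus (K := R_AbsRing) (V := R_NormedModule)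
    Phi1); [apply is_derive_arc_average1|apply is_derive_scal, is_derive_dgeg_cos])).
  specialize (HE HO p Hp).
  assert (HY0 : Y 0 = 0).
  { unfold Y, Phi, c. rewrite cos_0.
    rewrite (cint_ext m _ (fun v => gegenbauer lam k s * 1)).
    - rewrite cint_scal by (intros; cont1d). field. lra.
    - intros v _. unfold z. rewrite cos_0, sin_0.
      replace (s * 1 + sg * 0 * v) with s by ring. ring. }
  assert (HY1 : Y1 0 = 0).
  (* At [p = 0] the equation degenerates to [2 * lam * Y1 0 = 0], so the initial slope needs no
     computation. *)
  { pose proof (HO 0) as A. rewrite sin_0, cos_0 in A.
    apply (Rmult_eq_reg_l (2 * lam)); lra. }
  rewrite HY0, HY1 in HE.
  assert (0 <= Y1 p ^ 2 / (INR k * (INR k + 2 * lam)))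
    by (apply Rdiv_le_0_compat; [apply pow2_ge_0|exact Hmu]).
  replace (0 ^ 2 / (INR k * (INR k + 2 * lam))) with 0 in HE by (unfold Rdiv; ring).
  assert (HYp : Y p = 0) by nra.
  unfold Y in HYp. replace (Phi p) with (c * gegenbauer lam k (cos p)) by lra.
  unfold c; field; lra.
Qed.
End Product.

Lemma gegenbauer_product (m k : nat) (s t : R) :
  let lam := (INR m + 1) / 2 in -1 <= s <= 1 -> 0 <= t <= 1 ->
  cint m (fun v => gegenbauer lam k (s * t + sqrt (1 - s ^ 2) * sqrt (1 - t ^ 2) * v))
  = cint m (fun _ => 1) * gegenbauer lam k s * gegenbauer lam k t / gegenbauer lam k 1.
Proof.
  intros lam Hs Ht.
  pose proof (arc_average_eq m k s (sqrt (1 - s ^ 2))) as H.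
  specialize (H ltac:(rewrite pow2_sqrt by nra; ring) (acos t) (acos_bound_pos t Ht)).
  rewrite cos_acos, sin_acos in H by lra. fold lam in H.
  unfold Rsqr in H. rewrite <- H. apply cint_ext. intros v _.
  replace (t * t) with (t ^ 2) by ring.
  rewrite cos_acos by lra. reflexivity.
Qed.

(** The generating function at [s t + q v] is averaged over [v]: the product formula splits each
    term, and a normalised average preserves the uniform error. *)
Lemma kernel_uniform (m : nat) (rho : R) : 0 < rho < 1 ->
  let lam := (INR m + 1) / 2 in
  exists e : nat -> R, is_lim_seq e 0 /\ forall s t N, -1 <= s <= 1 -> 0 <= t <= 1 ->
    Rabs (sum_f_R0 (fun k => / gegenbauer lam k 1 * gegenbauer lam k s
                              * gegenbauer lam k t * rho ^ k) N
      - / cint m (fun _ => 1) * cint m (fun v => Rpower (1 + rho ^ 2 - 2 * rho * (s * t)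
          - 2 * rho * (sqrt (1 - s ^ 2) * sqrt (1 - t ^ 2)) * v) (- lam))) <= e N.
Proof.
  intros Hrho lam.
  assert (Hlam : 0 < lam) by apply half_succ_pos.
  destruct (gegenbauer_generating_uniform lam rho Hlam Hrho) as [e [He Hb]].
  exists e. split; [exact He|]. intros s t N Hs Ht.
  set (I := cint m (fun _ => 1)).
  assert (HI : 0 < I).
  { apply cint_gt_0; intros; [apply continuous_const|lra]. }
  set (q := sqrt (1 - s ^ 2) * sqrt (1 - t ^ 2)).
  assert (Hz : forall v, -1 <= v <= 1 -> -1 <= s * t + q * v <= 1).
  { intros v Hv.
    assert (Hq : 0 <= q) by (apply Rmult_le_pos; apply sqrt_pos).
    assert (Hq2 : q ^ 2 = (1 - s ^ 2) * (1 - t ^ 2)).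
    { unfold q. rewrite Rpow_mult_distr, !pow2_sqrt by nra. reflexivity. }
    (* Here [(1 - s t)^2 - q^2 = (s - t)^2], and likewise with the sign of [t] reversed. *)
    assert (q <= 1 - s * t).
    { apply Rsqr_incr_0_var; [|nra]. unfold Rsqr.
      pose proof (pow2_ge_0 (s - t)). simpl in *; lra. }
    assert (q <= 1 + s * t).
    { apply Rsqr_incr_0_var; [|nra]. unfold Rsqr.
      pose proof (pow2_ge_0 (s + t)). simpl in *; lra. }
    nra. }
  set (g := fun v => Rpower (1 - 2 * (s * t + q * v) * rho + rho ^ 2) (- lam)).
  set (h := fun v => sum_f_R0 (fun k => gegenbauer lam k (s * t + q * v) * rho ^ k) N).
  assert (Hg : forall v, -1 <= v <= 1 -> continuous g v).
  { intros v Hv. apply (ex_derive_continuous g). unfold g, Rpower. auto_derive.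
    specialize (Hz v Hv). nra. }
  assert (Hh : forall n v, continuous
     (fun v => sum_f_R0 (fun k => gegenbauer lam k (s * t + q * v) * rho ^ k) n) v).
  { intros n v. induction n as [|n IH]; simpl sum_f_R0; cont1d.
    exact IH. }
  assert (Eh : forall n, cint m (fun v => sum_f_R0 (fun k => gegenbauer lam k (s * t + q * v)
     * rho ^ k) n) = I * sum_f_R0 (fun k => / gegenbauer lam k 1 * gegenbauer lam k s
                              * gegenbauer lam k t * rho ^ k) n).
  { assert (E1 : forall k, cint m (fun v => gegenbauer lam k (s * t + q * v) * rho ^ k)
       = I * (/ gegenbauer lam k 1 * gegenbauer lam k s * gegenbauer lam k t * rho ^ k)).
    { intros k. rewrite (cint_ext m _ (fun v => rho ^ k * gegenbauer lam k (s * t + q * v)))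
        by (intros; ring).
      rewrite cint_scal by (intros; cont1d).
      pose proof (gegenbauer_product m k s t Hs Ht) as E2. cbv zeta in E2.
      fold lam q I in E2. rewrite E2.
      pose proof (gegenbauer_at_1_pos lam k Hlam). field. lra. }
    induction n as [|n IH]; simpl sum_f_R0; [apply E1|].
    rewrite cint_plus by (intros; cont1d; apply Hh).
    rewrite IH, E1, <- Rmult_plus_distr_l. reflexivity. }
  rewrite (cint_ext m _ g) by (intros; unfold g; f_equal; ring).
  replace (sum_f_R0 _ N) with (/ I * cint m h) by (unfold h; rewrite Eh; field; lra).
  rewrite <- Rmult_minus_distr_l, Rabs_mult, (Rabs_pos_eq (/ I))
    by (left; apply Rinv_0_lt_compat, HI).
  apply (Rmult_le_reg_l I); [exact HI|].
  rewrite <- Rmult_assoc, Rinv_r, Rmult_1_l by lra.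
  assert (Hd : forall v, -1 <= v <= 1 -> - e N <= h v - g v <= e N).
  { intros v Hv. apply Rabs_le_between. apply Hb, Hz, Hv. }
  assert (EN : forall c : R, cint m (fun _ => c) = I * c).
  { intros c. rewrite (cint_ext m _ (fun _ => c * 1)) by (intros; ring).
    rewrite cint_scal by (intros; apply continuous_const). unfold I; ring. }
  assert (Hhc : forall v, -1 <= v <= 1 -> continuous h v) by (intros; apply Hh).
  assert (U1 : cint m h <= cint m (fun v => g v + e N)).
  { apply cint_le; [exact Hhc| |].
    - intros v Hv.
      apply (continuous_plus (K := R_AbsRing) (V := R_NormedModule) g (fun _ => e N));
        [apply Hg, Hv|apply continuous_const].
    - intros v Hv. specialize (Hd v Hv). lra. }
  assert (U2 : cint m g <= cint m (fun v => h v + e N)).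
  { apply cint_le; [exact Hg| |].
    - intros v Hv.
      apply (continuous_plus (K := R_AbsRing) (V := R_NormedModule) h (fun _ => e N));
        [apply Hhc, Hv|apply continuous_const].
    - intros v Hv. specialize (Hd v Hv). lra. }
  rewrite cint_plus, EN in U1 by (auto; intros; apply continuous_const).
  rewrite cint_plus, EN in U2 by (auto; intros; apply continuous_const).
  apply Rabs_le_between. lra.
Qed.

(** * Moments of the kernel *)

(** Pulling [A] out of [X = A - B v] gives the average of [X^(-s)] as [A^(-s) * mom m s (B / A)], so
    only one shape parameter is left to differentiate in. *)
Definition mom (m : nat) (s b : R) : R :=
  / cint m (fun _ => 1) * cint m (fun v => Rpower (1 - b * v) (- s)).

Lemma cint_1_pos (m : nat) : 0 < cint m (fun _ => 1).
Proof. apply cint_gt_0; intros; [apply continuous_const|lra]. Qed.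

Lemma Rpower_succ (x s : R) : 0 < x -> Rpower x (- s) = x * Rpower x (- (s + 1)).
Proof.
  intros Hx. rewrite <- (Rpower_1 x) at 2 by exact Hx. rewrite <- Rpower_plus.
  f_equal. ring.
Qed.

Lemma one_sub_mul_pos (b v : R) : -1 < b < 1 -> -1 <= v <= 1 -> 0 < 1 - b * v.
Proof. intros; destruct (Rle_dec 0 v); nra. Qed.

Lemma is_derive_Rpower_affine_l (s b v : R) : 0 < 1 - b * v ->
  is_derive (fun u => Rpower (1 - u * v) (- s)) b (s * v * Rpower (1 - b * v) (- (s + 1))).
Proof.
  intros H. replace (s * v * Rpower (1 - b * v) (- (s + 1)))
    with (s * v * / (1 - b * v) * Rpower (1 - b * v) (- s)).
  2:{ rewrite (Rpower_succ _ s) by exact H. field. lra. }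
  unfold Rpower. auto_derive; [lra|]. unfold Rminus. field. lra.
Qed.

Lemma is_derive_Rpower_affine_r (s b v : R) : 0 < 1 - b * v ->
  is_derive (fun u => Rpower (1 - b * u) (- s)) v (s * b * Rpower (1 - b * v) (- (s + 1))).
Proof.
  intros H. replace (s * b * Rpower (1 - b * v) (- (s + 1)))
    with (s * b * / (1 - b * v) * Rpower (1 - b * v) (- s)).
  2:{ rewrite (Rpower_succ _ s) by exact H. field. lra. }
  unfold Rpower. auto_derive; [lra|]. unfold Rminus. field. lra.
Qed.

Lemma continuous_Rpower_affine (s b v : R) : -1 < b < 1 -> -1 <= v <= 1 ->
  continuous (fun u => Rpower (1 - b * u) (- s)) v.
Proof.
  intros Hb Hv. apply (ex_derive_continuous (fun u => Rpower (1 - b * u) (- s))).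
  eexists. apply is_derive_Rpower_affine_r, one_sub_mul_pos; assumption.
Qed.

Ltac cont_pw := intros; simpl pow; cont1d; try (apply continuous_Rpower_affine; assumption).

Definition dmom (m : nat) (s b : R) : R :=
  / cint m (fun _ => 1) * cint m (fun v => s * v * Rpower (1 - b * v) (- (s + 1))).

Lemma is_derive_mom (m : nat) (s b : R) : -1 < b < 1 ->
  is_derive (mom m s) b (dmom m s b).
Proof.
  intros Hb. unfold mom, dmom. apply (is_derive_scal (fun b => cint m _)).
  assert (Hloc : locally b (fun x => -1 < x < 1)).
  { apply (locally_interval _ b (-1) 1); simpl; [lra|lra|]. intros; simpl in *; lra. }
  apply (is_derive_cint m (fun b v => Rpower (1 - b * v) (- s))
    (fun b v => s * v * Rpower (1 - b * v) (- (s + 1)))).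
  - revert Hloc. apply filter_imp. intros x Hx v Hv.
    apply is_derive_Rpower_affine_l, one_sub_mul_pos; assumption.
  - intros v Hv. apply continuity_2d_pt_mult; [cont2d|].
    apply (continuity_1d_2d_pt_comp (fun X => Rpower X (- (s + 1))) (fun u v => 1 - u * v));
      [|cont2d].
    pose proof (one_sub_mul_pos b v Hb Hv).
    apply continuity_pt_filterlim.
    apply (ex_derive_continuous (fun X => Rpower X (- (s + 1)))).
    unfold Rpower. auto_derive. lra.
  - revert Hloc. apply filter_imp. intros x Hx v Hv.
    apply continuous_Rpower_affine; assumption.
Qed.

(** The factor [b] turns [b v] into [1 - (1 - b v)], which leaves two moments and avoids a division
    at [b = 0]. *)
Lemma dmom_eq (m : nat) (s b : R) : -1 < b < 1 ->
  b * dmom m s b = s * (mom m (s + 1) b - mom m s b).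
Proof.
  intros Hb. unfold dmom, mom.
  transitivity (/ cint m (fun _ => 1) * (s * (cint m (fun v => Rpower (1 - b * v) (- (s + 1)))
    + (-1) * cint m (fun v => Rpower (1 - b * v) (- s))))); [|ring].
  transitivity (/ cint m (fun _ => 1) *
    (b * cint m (fun v => s * v * Rpower (1 - b * v) (- (s + 1))))); [ring|].
  f_equal.
  rewrite <- !cint_scal, <- cint_plus, <- cint_scal by cont_pw.
  apply cint_ext. intros v Hv. rewrite (Rpower_succ _ s) by (apply one_sub_mul_pos; auto).
  ring.
Qed.

Lemma mom_by_parts (m : nat) (b : R) : -1 < b < 1 -> let lam := (INR m + 1) / 2 in
  2 * cint m (fun v => v * Rpower (1 - b * v) (- lam))
  = b * cint m (fun v => (1 - v ^ 2) * Rpower (1 - b * v) (- (lam + 1))).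
Proof.
  intros Hb lam.
  pose proof (cint_by_parts m (fun v => Rpower (1 - b * v) (- lam))
    (fun v => lam * b * Rpower (1 - b * v) (- (lam + 1)))) as H.
  specialize (H ltac:(intros; apply is_derive_Rpower_affine_r, one_sub_mul_pos; assumption)
    ltac:(cont_pw)).
  replace (INR m + 1) with (lam * 2) in H by (unfold lam; field).
  rewrite (cint_ext m (fun v => (1 - v ^ 2) * _)
    (fun v => lam * b * ((1 - v ^ 2) * Rpower (1 - b * v) (- (lam + 1))))) in H
    by (intros; ring).
  rewrite (cint_scal m (lam * b)) in H by cont_pw.
  assert (0 < lam) by apply half_succ_pos.
  apply (Rmult_eq_reg_l lam); [|lra]. rewrite <- !Rmult_assoc. exact H.
Qed.

(** With [X = 1 - b v] one has [2 b v = 2 - 2 X] and [b^2 (1 - v^2) = 2 X - X^2 - (1 - b^2)]. In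
    [mom_by_parts] times [b] the averages of [X^(-lam)] then cancel. *)
Lemma mom_reflection (m : nat) (b : R) : -1 < b < 1 -> let lam := (INR m + 1) / 2 in
  (1 - b ^ 2) * mom m (lam + 1) b = mom m (lam - 1) b.
Proof.
  intros Hb lam. pose proof (mom_by_parts m b Hb) as H. cbv zeta in H. fold lam in H.
  unfold mom.
  enough (E : (1 - b ^ 2) * cint m (fun v => Rpower (1 - b * v) (- (lam + 1)))
     = cint m (fun v => Rpower (1 - b * v) (- (lam - 1)))).
  { rewrite <- E. ring. }
  apply (f_equal (Rmult b)) in H.
  rewrite <- !Rmult_assoc, <- !cint_scal in H by cont_pw.
  rewrite <- cint_scal by cont_pw.
  assert (S : forall v, -1 <= v <= 1 ->
    Rpower (1 - b * v) (- (lam - 1)) = (1 - b * v) * Rpower (1 - b * v) (- lam) /\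
    Rpower (1 - b * v) (- lam) = (1 - b * v) * Rpower (1 - b * v) (- (lam + 1))).
  { intros v Hv. pose proof (one_sub_mul_pos b v Hb Hv).
    split; [|apply Rpower_succ; assumption].
    rewrite Rpower_succ by assumption. do 2 f_equal. ring. }
  rewrite (cint_ext m (fun v => b * 2 * _) (fun v =>
     b * b * ((1 - v ^ 2) * Rpower (1 - b * v) (- (lam + 1)))
     + ((-1) * Rpower (1 - b * v) (- (lam - 1))
        + (1 - b ^ 2) * Rpower (1 - b * v) (- (lam + 1))))) in H.
  2:{ intros v Hv. destruct (S v Hv) as [-> S2]. rewrite S2. ring. }
  rewrite cint_plus in H by cont_pw. rewrite cint_plus in H by cont_pw.
  rewrite (cint_scal m (-1)) in H by cont_pw. lra.
Qed.

Lemma mom_pos (m : nat) (s b : R) : -1 < b < 1 -> 0 < mom m s b.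
Proof.
  intros Hb. apply Rmult_lt_0_compat; [apply Rinv_0_lt_compat, cint_1_pos|].
  apply cint_gt_0; [cont_pw|intros; apply exp_pos].
Qed.

Lemma mom_0 (m : nat) (s : R) : mom m s 0 = 1.
Proof.
  unfold mom. rewrite (cint_ext m (fun v => Rpower _ _) (fun _ => 1)).
  - apply Rinv_l. pose proof (cint_1_pos m). lra.
  - intros v _. replace (1 - 0 * v) with 1 by ring.
    unfold Rpower. rewrite ln_1, Rmult_0_r. apply exp_0.
Qed.

(* Expand the average of [X^(-lam-1) (X - D)^2 >= 0]. *)
Lemma mom_lower (m : nat) (b : R) : -1 < b < 1 -> let lam := (INR m + 1) / 2 in
  sqrt (1 - b ^ 2) * mom m lam b <= mom m (lam - 1) b.
Proof.
  intros Hb lam. set (D := sqrt (1 - b ^ 2)).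
  assert (HD : D ^ 2 = 1 - b ^ 2) by (apply pow2_sqrt; nra).
  pose proof (mom_reflection m b Hb) as H. cbv zeta in H. fold lam in H.
  enough (E : 0 <= mom m (lam - 1) b + (- 2 * D * mom m lam b + D ^ 2 * mom m (lam + 1) b)).
  { rewrite HD, H in E. lra. }
  unfold mom.
  transitivity (/ cint m (fun _ => 1) * (cint m (fun v => Rpower (1 - b * v) (- (lam - 1)))
    + ((-2 * D) * cint m (fun v => Rpower (1 - b * v) (- lam))
       + D ^ 2 * cint m (fun v => Rpower (1 - b * v) (- (lam + 1)))))); [|right; ring].
  apply Rmult_le_pos; [left; apply Rinv_0_lt_compat, cint_1_pos|].
  rewrite <- !cint_scal by cont_pw. rewrite <- cint_plus by cont_pw.
  rewrite <- cint_plus by cont_pw.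
  replace 0 with (cint m (fun _ => 0)).
  2:{ rewrite (cint_ext m _ (fun _ => 0 * 1)) by (intros; ring).
      rewrite cint_scal by cont_pw. ring. }
  apply cint_le; [cont_pw|cont_pw|].
  intros v Hv. pose proof (one_sub_mul_pos b v Hb Hv) as Hp.
  rewrite (Rpower_succ _ (lam - 1)), (Rpower_succ _ lam) by exact Hp.
  replace (lam - 1 + 1) with lam by ring. rewrite (Rpower_succ _ lam) by exact Hp.
  assert (0 < Rpower (1 - b * v) (- (lam + 1))) by apply exp_pos.
  replace (_ + _) with (Rpower (1 - b * v) (- (lam + 1)) * (1 - b * v - D) ^ 2) by ring.
  apply Rmult_le_pos; [lra|apply pow2_ge_0].
Qed.

(* At a negative minimum the left difference quotients would be nonpositive. *)
Lemma nonneg_of_derive_pos_where_neg (f f1 : R -> R) (b : R) : 0 <= b ->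
  (forall x, 0 <= x <= b -> is_derive f x (f1 x)) -> 0 <= f 0 ->
  (forall x, 0 < x <= b -> f x < 0 -> 0 < f1 x) -> 0 <= f b.
Proof.
  intros Hb Hd H0 Hs.
  destruct (Rle_dec 0 (f b)) as [Hfb|Hfb]; [exact Hfb|exfalso].
  destruct (continuity_ab_min f 0 b Hb) as [x [Hx Hxb]].
  { intros c Hc. apply derivable_continuous_pt. exists (f1 c).
    apply is_derive_Reals, Hd, Hc. }
  assert (Hfx : f x < 0) by (specialize (Hx b ltac:(lra)); lra).
  assert (Hx0 : 0 < x) by (destruct (Req_dec x 0) as [->|]; lra).
  pose proof (Hs x ltac:(lra) Hfx) as Hl.
  pose proof (proj1 (is_derive_Reals _ _ _) (Hd x Hxb)) as Hlim.
  destruct (Hlim _ Hl) as [d Hdel]. pose proof (cond_pos d).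
  set (h := - Rmin (d / 2) (x / 2)).
  assert (Hh : 0 < Rmin (d / 2) (x / 2)) by (apply Rmin_pos; lra).
  pose proof (Rmin_l (d / 2) (x / 2)). pose proof (Rmin_r (d / 2) (x / 2)).
  assert (Hq := Hdel h). unfold h in Hq at 1 2.
  specialize (Hq ltac:(lra)). rewrite Rabs_Ropp, Rabs_pos_eq in Hq by lra.
  specialize (Hq ltac:(lra)). apply Rabs_lt_between in Hq.
  assert (Hle : f x <= f (x + h)) by (apply Hx; unfold h; lra).
  assert (Hpos : 0 < (f (x + h) - f x) / h) by lra.
  assert (Hneg : (f (x + h) - f x) / h <= 0).
  { replace ((f (x + h) - f x) / h) with (- ((f (x + h) - f x) / (- h)))
      by (field; unfold h; lra).
    assert (0 <= (f (x + h) - f x) / - h); [|lra].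
    apply Rdiv_le_0_compat; unfold h in *; lra. }
  lra.
Qed.

(* The difference of the two sides vanishes at [b = 0] and its derivative is positive wherever
   it is negative. *)
Lemma mom_upper (m : nat) (b : R) : 0 <= b < 1 -> let lam := (INR m + 1) / 2 in
  1 <= lam ->
  (2 * lam + 1) * mom m (lam - 1) b <= (2 * lam * sqrt (1 - b ^ 2) + 1) * mom m lam b.
Proof.
  intros Hb lam Hlam.
  set (P := fun x => (2 * lam * sqrt (1 - x ^ 2) + 1) * mom m lam x
                     - (2 * lam + 1) * mom m (lam - 1) x).
  set (P1 := fun x => - 2 * lam * x / sqrt (1 - x ^ 2) * mom m lam x
     + (2 * lam * sqrt (1 - x ^ 2) + 1) * dmom m lam x
     - (2 * lam + 1) * dmom m (lam - 1) x).
  enough (E : 0 <= P b) by (unfold P in E; lra).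
  apply (nonneg_of_derive_pos_where_neg P P1); [lra| | |].
  - intros x Hx.
    pose proof (is_derive_mom m lam x ltac:(lra)) as K1.
    pose proof (is_derive_mom m (lam - 1) x ltac:(lra)) as K2.
    assert (Hpos : 0 < 1 - x ^ 2) by nra.
    unfold P, P1. auto_derive.
    + repeat split; try (eexists; eassumption). simpl in Hpos; lra.
    + rewrite (is_derive_unique _ _ _ K1 : Derive (fun x : R => mom m lam x) x = _),
        (is_derive_unique _ _ _ K2 : Derive (fun x : R => mom m (lam - 1) x) x = _).
      replace (1 + - (x * (x * 1))) with (1 - x ^ 2) by ring.
      assert (0 < sqrt (1 - x ^ 2)) by (apply sqrt_lt_R0; lra).
      field. lra.
  - unfold P. rewrite !mom_0. replace (1 - 0 ^ 2) with 1 by ring. rewrite sqrt_1. lra.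
  - intros x Hx HP.
    pose proof (dmom_eq m lam x ltac:(lra)) as K1.
    pose proof (dmom_eq m (lam - 1) x ltac:(lra)) as K2.
    pose proof (mom_reflection m x ltac:(lra)) as K3. cbv zeta in K3. fold lam in K3.
    replace (lam - 1 + 1) with lam in K2 by ring.
    pose proof (mom_pos m lam x ltac:(lra)) as HK.
    assert (Hpos : 0 < 1 - x ^ 2) by nra.
    set (D := sqrt (1 - x ^ 2)) in *.
    assert (HD : 0 < D) by (apply sqrt_lt_R0; exact Hpos).
    assert (HD2 : D ^ 2 = 1 - x ^ 2) by (apply pow2_sqrt; lra).
    unfold P in HP. fold D in HP.
    set (K := mom m lam x) in *. set (J := mom m (lam - 1) x) in *.
    assert (K3' : mom m (lam + 1) x = J / D ^ 2) by (rewrite HD2, <- K3; field; lra).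
    rewrite K3' in K1.
    apply (Rmult_lt_reg_l x); [lra|]. rewrite Rmult_0_r.
    unfold P1. fold D K.
    replace (x * (-2 * lam * x / D * K + (2 * lam * D + 1) * dmom m lam x
              - (2 * lam + 1) * dmom m (lam - 1) x))
      with (-2 * lam * x ^ 2 / D * K + (2 * lam * D + 1) * (x * dmom m lam x)
              - (2 * lam + 1) * (x * dmom m (lam - 1) x)) by (field; lra).
    rewrite K1, K2. replace (x ^ 2) with (1 - D ^ 2) by lra.
    (* [c] is the coefficient of [J] in [x * P1 x]. Eliminating [J] through [P x] leaves
       [- c * P x / (2 * lam + 1)] plus a nonnegative multiple of [(1 - D)^2]. *)
    set (c := (2 * lam * D + 1) * lam / D ^ 2 + (2 * lam + 1) * (lam - 1)).
    assert (Hc : 0 < c).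
    { unfold c. assert (0 < (2 * lam * D + 1) * lam / D ^ 2).
      { apply Rdiv_lt_0_compat; [nra|apply pow_lt; exact HD]. }
      nra. }
    replace (_ - _) with (c * (((2 * lam + 1) * J - (2 * lam * D + 1) * K) / (2 * lam + 1))
      + K * (lam * (1 - D) ^ 2 / (D ^ 2 * (2 * lam + 1)))) by (unfold c; field; lra).
    apply Rplus_lt_le_0_compat.
    + apply Rmult_lt_0_compat; [exact Hc|]. apply Rdiv_lt_0_compat; lra.
    + apply Rmult_le_pos; [lra|]. apply Rdiv_le_0_compat.
      * apply Rmult_le_pos; [lra|apply pow2_ge_0].
      * apply Rmult_lt_0_compat; [apply pow_lt; exact HD|lra].
Qed.

(** The terms [A_k' C_k'] sum to a kernel with parameter [lam + 1]; this brings it back to the two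
    moments that the slope inequality uses. *)
Lemma mom_SS (m : nat) (b : R) : -1 < b < 1 -> let lam := (INR m + 1) / 2 in
  lam * b ^ 2 * mom (m + 2) (lam + 1) b = (2 * lam + 1) * (mom m lam b - mom m (lam - 1) b).
Proof.
  intros Hb lam. pose proof (mom_by_parts m b Hb) as H. cbv zeta in H. fold lam in H.
  assert (Hlam : 0 < lam) by apply half_succ_pos.
  pose proof (cint_1_pos m) as HI. unfold mom. rewrite !cint_SS.
  set (I := cint m (fun _ => 1)) in *.
  (* Integration by parts with [g v = v] gives the ratio of the two normalising constants. *)
  assert (E : (2 * lam + 1) * cint m (fun v => (1 - v ^ 2) * 1) = 2 * lam * I).
  { pose proof (cint_by_parts m (fun v => v) (fun _ => 1)) as B.
    specialize (B ltac:(intros; apply @is_derive_id) ltac:(intros; apply continuous_const)).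
    cbv beta in B.
    replace (cint m (fun v => v * v)) with (I - cint m (fun v => (1 - v ^ 2) * 1)) in B.
    - replace (INR m + 1) with (2 * lam) in B by (unfold lam; field). lra.
    - unfold I. transitivity (cint m (fun v => 1 + (-1) * ((1 - v ^ 2) * 1))).
      + rewrite cint_plus, cint_scal by cont_pw. ring.
      + apply cint_ext. intros; ring. }
  replace (cint m (fun v => (1 - v ^ 2) * 1)) with (2 * lam / (2 * lam + 1) * I)
    by (apply (Rmult_eq_reg_l (2 * lam + 1)); [|lra];
        rewrite E; field; lra).
  assert (H2 : b ^ 2 * cint m (fun v => (1 - v ^ 2) * Rpower (1 - b * v) (- (lam + 1)))
    = 2 * (cint m (fun v => Rpower (1 - b * v) (- lam))
           - cint m (fun v => Rpower (1 - b * v) (- (lam - 1))))).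
  { replace (b ^ 2 * cint m (fun v => (1 - v ^ 2) * Rpower (1 - b * v) (- (lam + 1))))
      with (b * (2 * cint m (fun v => v * Rpower (1 - b * v) (- lam)))) by (rewrite H; ring).
    transitivity (2 * (b * cint m (fun v => v * Rpower (1 - b * v) (- lam)))); [ring|].
    f_equal. transitivity (cint m (fun v => Rpower (1 - b * v) (- lam))
      + (-1) * cint m (fun v => Rpower (1 - b * v) (- (lam - 1)))); [|ring].
    rewrite <- !cint_scal, <- cint_plus by cont_pw.
    apply cint_ext. intros v Hv. pose proof (one_sub_mul_pos b v Hb Hv).
    rewrite (Rpower_succ _ (lam - 1)) by assumption.
    replace (lam - 1 + 1) with lam by ring. ring. }
  transitivity (lam * / (2 * lam / (2 * lam + 1) * I) *
    (b ^ 2 * cint m (fun v => (1 - v ^ 2) * Rpower (1 - b * v) (- (lam + 1))))); [ring|].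
  rewrite H2. field. lra.
Qed.

(** * The slope inequality *)

Lemma div_add_1_bounds (l : R) : 0 < l -> 0 < l / (l + 1) < 1.
Proof.
  intros Hl. split; [apply Rdiv_lt_0_compat; lra|].
  apply (Rmult_lt_reg_r (l + 1)); [lra|]. field_simplify; lra.
Qed.

Ltac nonneg_coefficients :=
  ring_simplify;
  repeat first [ apply Rplus_le_le_0_compat | apply Rmult_le_pos | apply pow_le
               | assumption | lra ].

(* In the variables [c = 1 - rho^2], [u = D - c] and [v = (1 + rho^2 - 2 delta rho) - D],
   where [u + v = 2 rho^2 / (l + 1)], positive multiples of the coefficients of [J] and [K] in
   the slope inequality, and of [2 l D + A]. *)
Section Slopes.
Variables (l c u v : R).
Hypotheses (Hu : 0 <= u) (Hv : 0 <= v) (Hc : 0 <= c).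
Let h := u + v.
Let h2 := 2 * c + h.
Let D := c + u.
Let St := D * (2 * (l + 1) * c + (2 * l + 1) * h) + v * (2 * c + (l + 1) * h - l * u).
Definition NJ := h2 ^ 2 * St + 2 * l ^ 2 * v * (2 * D + v) * D ^ 2
  - 2 * (l - 1) * D ^ 2 * h2 * (2 * (l + 1) * c + (2 * l + 1) * h).
Definition NK := h2 * (2 * (l + 1) * c + (2 * l + 1) * h) + l * v * (2 * D + v)
  - 2 * (l - 1) * St.
Definition TA := (2 * l + 1) * D * h2 + v * h2 + l * v * (2 * D + v).

Lemma slope_low (Hl : 1 <= l) : 0 <= NJ - NK * (D * h2).
Proof.
  unfold NJ, NK, St, h2, h, D. assert (Ha : 0 <= l - 1) by lra.
  (* Expanded in [a = l - 1] as well as in [c], [u], [v], the polynomial has nonnegative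
     coefficients only. *)
  replace l with ((l - 1) + 1) by ring. generalize dependent (l - 1); intros a Ha.
  clear -Hu Hv Hc Ha. nonneg_coefficients.
Qed.

Lemma slope_high (Hl : 1 <= l) : 0 <= TA * NJ - (2 * l + 1) * NK * (D * h2) ^ 2.
Proof.
  unfold NJ, NK, TA, St, h2, h, D. assert (Ha : 0 <= l - 1) by lra.
  replace l with ((l - 1) + 1) by ring. generalize dependent (l - 1); intros a Ha.
  clear -Hu Hv Hc Ha. nonneg_coefficients.
Qed.

Lemma slope_half (Hl : l = 1 / 2) : 0 <= NJ - NK * (D * h2) /\ 0 <= NJ.
Proof.
  unfold NJ, NK, St, h2, h, D. subst l. clear -Hu Hv Hc.
  split; field_simplify; (apply Rdiv_le_0_compat; [nonneg_coefficients|lra]).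
Qed.
End Slopes.

(** Up to a positive factor this says that the profile decreases, with [x = rho^2], [y = t^2], and
    with [K], [J] standing for [mom m lam b] and [A * mom m (lam - 1) b]. *)
Lemma slope_inequality (l x y D K J : R) :
  let ka := l / (l + 1) in let be := 1 - ka * x in
  let S := (1 + ka ^ 2 * x) * (1 + x) - 4 * ka * x + 2 * ka * x * y * (1 - ka) * be in
  l = 1 / 2 \/ 1 <= l -> 0 < x < 1 -> 0 <= y <= 1 -> 0 < D ->
  D ^ 2 = (1 - x) ^ 2 + 4 * x * (1 - ka) * be * y -> 0 < K -> D * K <= J ->
  (1 <= l -> (2 * l + 1) * J <= (2 * l * D + (1 + x - 2 * ka * x * y)) * K) ->
  K * (be * (1 - ka ^ 2 * x) + be * (ka ^ 2 * x) * (1 - y) / l - (l - 1) * S)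
  <= J * (be * S / D ^ 2 + ka ^ 2 * x * (1 - y) - (l - 1) * (1 - ka ^ 2 * x)).
Proof.
  intros ka be S Hl Hx Hy HD HD2 HK HJ1 HJ2.
  assert (Hl0 : 0 < l) by lra.
  assert (Hka : 0 < ka < 1) by (apply div_add_1_bounds, Hl0).
  assert (Hbe : 0 < be) by (unfold be; nra).
  (* [D] grows from [c] at [y = 0] to [c + 2 x / (l + 1)] at [y = 1]; [u] and [v] are its distances
     to these two values. *)
  set (c := 1 - x). set (u := D - c). set (v := c + 2 * x / (l + 1) - D).
  assert (Hc : 0 <= c) by (unfold c; lra).
  assert (H4 : 0 < 4 * x * (1 - ka) * be) by (repeat apply Rmult_lt_0_compat; lra).
  assert (Hu : 0 <= u).
  { unfold u. enough (c <= D) by lra. apply Rsqr_incr_0_var; [|lra]. unfold Rsqr, c in *.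
    assert (0 <= 4 * x * (1 - ka) * be * y) by (apply Rmult_le_pos; lra).
    simpl in HD2; lra. }
  assert (Hxl : 0 < 2 * x / (l + 1)) by (apply Rdiv_lt_0_compat; lra).
  assert (E4 : 4 * x * (1 - ka) * be = (2 * x / (l + 1)) * (2 * c + 2 * x / (l + 1))).
  { unfold be, ka, c. field. lra. }
  assert (Hv : 0 <= v).
  { unfold v. enough (D <= c + 2 * x / (l + 1)) by lra.
    apply Rsqr_incr_0_var; [|lra]. unfold Rsqr.
    assert (4 * x * (1 - ka) * be * y <= 4 * x * (1 - ka) * be * 1)
      by (apply Rmult_le_compat_l; lra).
    rewrite E4 in *. fold c in HD2. simpl in HD2. nra. }
  assert (Ex : x = (l + 1) * (u + v) / 2) by (unfold u, v; field; lra).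
  assert (Huv : 0 < u + v) by (unfold u, v; lra).
  set (h2 := 2 * c + (u + v)).
  assert (Hh2 : 0 < h2) by (unfold h2; lra).
  assert (EDu : D = c + u) by (unfold u; ring).
  (* This is the relation [1 = c + (l + 1) (u + v) / 2]. It has been used to make [NJ], [NK] and
     [TA] homogeneous in [c], [u], [v], so the polynomial inequalities can treat these as
     independent. *)
  assert (Ec : c = 1 - (l + 1) * (u + v) / 2) by (rewrite <- Ex; reflexivity).
  assert (Ey : y = (D ^ 2 - c ^ 2) / ((u + v) * h2)).
  { rewrite HD2. fold c. rewrite E4. replace (2 * x / (l + 1)) with (u + v)
      by (unfold u, v; ring). unfold h2. field. unfold h2 in Hh2. lra. }
  assert (EJ : be * S / D ^ 2 + ka ^ 2 * x * (1 - y) - (l - 1) * (1 - ka ^ 2 * x)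
     = NJ l c u v / (4 * (l + 1) * D ^ 2 * h2)).
  { unfold S, be, ka, NJ. rewrite Ey. unfold h2. rewrite EDu in *.
    clearbody u v c. clear -Ex Ec Hl0 Huv HD Hh2. unfold h2 in Hh2.
    subst x. subst c. field. repeat split; lra. }
  assert (EK : be * (1 - ka ^ 2 * x) + be * (ka ^ 2 * x) * (1 - y) / l - (l - 1) * S
     = NK l c u v / (4 * (l + 1))).
  { unfold S, be, ka, NK. rewrite Ey. unfold h2. rewrite EDu in *.
    clearbody u v c. clear -Ex Ec Hl0 Huv HD Hh2. unfold h2 in Hh2.
    subst x. subst c. field. repeat split; lra. }
  assert (EA : 2 * l * D + (1 + x - 2 * ka * x * y) = TA l c u v / h2).
  { unfold ka, TA. rewrite Ey. unfold h2. rewrite EDu in *.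
    clearbody u v c. clear -Ex Ec Hl0 Huv HD Hh2. unfold h2 in Hh2.
    subst x. subst c. field. repeat split; lra. }
  rewrite EJ, EK. rewrite EA in HJ2. clear EJ EK EA.
  set (nj := NJ l c u v) in *. set (nk := NK l c u v) in *. set (ta := TA l c u v) in *.
  assert (Hden : 0 < 4 * (l + 1) * D ^ 2 * h2).
  { apply Rmult_lt_0_compat; [apply Rmult_lt_0_compat; [lra|apply pow_lt, HD]|exact Hh2]. }
  replace (K * (nk / (4 * (l + 1)))) with (K * nk * (D ^ 2 * h2) / (4 * (l + 1) * D ^ 2 * h2))
    by (field; repeat split; lra).
  replace (J * (nj / (4 * (l + 1) * D ^ 2 * h2))) with (J * nj / (4 * (l + 1) * D ^ 2 * h2))
    by (field; repeat split; lra).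
  apply Rmult_le_compat_r; [left; apply Rinv_0_lt_compat, Hden|].
  assert (V1 : 0 <= nj - nk * (D * h2)).
  { rewrite EDu. destruct Hl as [Hl|Hl].
    - apply (slope_half l c u v Hu Hv Hc Hl).
    - apply (slope_low l c u v Hu Hv Hc Hl). }
  (* The inequality is linear in [J]: with a nonnegative coefficient its worst case is the lower
     bound [D * K], with a negative one it is the upper bound. *)
  destruct (Rle_dec 0 nj) as [Hn|Hn].
  - apply Rle_trans with (D * K * nj); [|apply Rmult_le_compat_r; lra].
    assert (0 <= D * K * (nj - nk * (D * h2))).
    { apply Rmult_le_pos; [apply Rmult_le_pos; lra|exact V1]. }
    lra.
  - destruct Hl as [Hl|Hl].
    (* At [l = 1/2] the coefficient is never negative, which is why the upper bound is assumed for
       [1 <= l] only. *)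
    { exfalso. pose proof (proj2 (slope_half l c u v Hu Hv Hc Hl)). fold nj in H. lra. }
    specialize (HJ2 Hl).
    pose proof (slope_high l c u v Hu Hv Hc Hl) as V2.
    rewrite <- EDu in V2. fold h2 nj nk ta in V2.
    apply (Rmult_le_reg_l ((2 * l + 1) * h2)); [apply Rmult_lt_0_compat; lra|].
    apply Rle_trans with (ta * K * nj).
    + assert (0 <= K * (ta * nj - (2 * l + 1) * nk * (D * h2) ^ 2))
        by (apply Rmult_le_pos; lra).
      lra.
    + replace ((2 * l + 1) * h2 * (J * nj)) with ((2 * l + 1) * J * h2 * nj) by ring.
      enough ((2 * l + 1) * J * h2 <= ta * K) by nra.
      replace (ta * K) with (ta / h2 * K * h2) by (field; lra).
      apply Rmult_le_compat_r; lra.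
Qed.

(** * Monotonicity of the profile *)

Section Profile.
Variables (m : nat) (rho : R).
Hypothesis Hrho : 0 < rho < 1.
Let lam := (INR m + 1) / 2.
Let ka := lam / (lam + 1).
Let x := rho ^ 2.
Let be := 1 - ka * x.

(* On the curve [a = delta t], with [y = t^2]: [pA = A], [pb = B / A] and [pu = 1 - a^2]. *)
Definition pA (y : R) : R := 1 + x - 2 * ka * x * y.
Definition pu (y : R) : R := 1 - ka ^ 2 * x * y.
Definition pb (y : R) : R := 2 * rho * sqrt (pu y * (1 - y)) / pA y.
Definition profile (y : R) : R :=
  Rpower (pu y) (lam - 1 / 2) * Rpower (pA y) (- lam)
  * (be * mom m lam (pb y) + lam * pA y * mom m (lam - 1) (pb y)).

(** [lam] runs through half-integers, so nothing lies between the case without [mom_upper] and its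
    range. *)
Lemma profile_lam_cases : lam = 1 / 2 \/ 1 <= lam.
Proof.
  unfold lam. destruct m as [|m']; [left; simpl; lra|right].
  rewrite S_INR. pose proof (pos_INR m'); lra.
Qed.

Lemma kappa_range : 0 < ka < 1.
Proof. apply div_add_1_bounds, half_succ_pos. Qed.

Lemma rho_sq_range : 0 < x < 1.
Proof. unfold x. split; [apply pow_lt; lra|]. nra. Qed.

Lemma pA_pos (y : R) : 0 <= y <= 1 -> 0 < pA y.
Proof.
  intros Hy. pose proof kappa_range. pose proof rho_sq_range. unfold pA.
  assert (ka * y <= 1 * 1) by (apply Rmult_le_compat; lra).
  assert (x * (ka * y) <= x * (1 * 1)) by (apply Rmult_le_compat_l; lra). lra.
Qed.

Lemma pu_pos (y : R) : 0 <= y <= 1 -> 0 < pu y.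
Proof.
  intros Hy. pose proof kappa_range. pose proof rho_sq_range. unfold pu.
  assert (ka ^ 2 < 1) by nra.
  assert (0 <= ka ^ 2) by nra.
  assert (ka ^ 2 * y <= 1 * 1) by (apply Rmult_le_compat; lra).
  assert (x * (ka ^ 2 * y) <= x * (1 * 1)) by (apply Rmult_le_compat_l; lra). lra.
Qed.

Lemma beta_pos : 0 < be.
Proof. pose proof kappa_range. pose proof rho_sq_range. unfold be; nra. Qed.

Let Dl (y : R) := (1 - x) ^ 2 + 4 * x * (1 - ka) * be * y.

Lemma Dl_pos (y : R) : 0 <= y -> 0 < Dl y.
Proof.
  intros Hy. pose proof kappa_range. pose proof rho_sq_range. pose proof beta_pos.
  unfold Dl. apply Rplus_lt_le_0_compat; [apply pow_lt; lra|].
  repeat apply Rmult_le_pos; lra.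
Qed.

Lemma pb_sq (y : R) : 0 <= y <= 1 -> 1 - pb y ^ 2 = Dl y / pA y ^ 2.
Proof.
  intros Hy. pose proof (pA_pos y Hy). pose proof (pu_pos y Hy).
  unfold pb. replace ((2 * rho * sqrt (pu y * (1 - y)) / pA y) ^ 2)
    with (4 * x * sqrt (pu y * (1 - y)) ^ 2 / pA y ^ 2) by (unfold x; field; lra).
  rewrite pow2_sqrt by (apply Rmult_le_pos; lra).
  apply (Rmult_eq_reg_r (pA y ^ 2)); [|apply Rgt_not_eq, pow_lt; lra].
  field_simplify; [|lra|lra]. unfold pA, pu, Dl, be. ring.
Qed.

Lemma pb_range (y : R) : 0 <= y < 1 -> 0 < pb y < 1.
Proof.
  intros Hy. pose proof (pA_pos y ltac:(lra)). pose proof (pu_pos y ltac:(lra)).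
  assert (0 < pb y).
  { unfold pb. apply Rdiv_lt_0_compat; [|lra].
    apply Rmult_lt_0_compat; [lra|]. apply sqrt_lt_R0, Rmult_lt_0_compat; lra. }
  split; [assumption|]. pose proof (pb_sq y ltac:(lra)) as E.
  assert (0 < Dl y / pA y ^ 2).
  { apply Rdiv_lt_0_compat; [apply Dl_pos; lra|apply pow_lt; lra]. }
  nra.
Qed.

(** The logarithmic derivative of [pb]. *)
Let gl (y : R) := - (1 + ka ^ 2 * x - 2 * ka ^ 2 * x * y) / (2 * pu y * (1 - y))
  + 2 * ka * x / pA y.

Lemma is_derive_pb (y : R) : 0 <= y < 1 -> is_derive pb y (gl y * pb y).
Proof.
  intros Hy. pose proof (pA_pos y ltac:(lra)) as HA. pose proof (pu_pos y ltac:(lra)) as Hu.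
  assert (Hp : 0 < pu y * (1 - y)) by (apply Rmult_lt_0_compat; lra).
  assert (Hs : 0 < sqrt (pu y * (1 - y))) by (apply sqrt_lt_R0, Hp).
  assert (Hs2 : sqrt (pu y * (1 - y)) ^ 2 = pu y * (1 - y)) by (apply pow2_sqrt; lra).
  assert (H1 : is_derive (fun y => sqrt (pu y * (1 - y))) y
    (- (1 + ka ^ 2 * x - 2 * ka ^ 2 * x * y) / (2 * sqrt (pu y * (1 - y))))).
  { unfold pu in *. auto_derive.
    - replace ((1 + - (ka * (ka * 1) * x * y)) * (1 + - y))
        with ((1 - ka ^ 2 * x * y) * (1 - y)) by ring. exact Hp.
    - replace ((1 + - (ka * (ka * 1) * x * y)) * (1 + - y))
        with ((1 - ka ^ 2 * x * y) * (1 - y)) by ring. field. lra. }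
  assert (H2 : is_derive pA y (- 2 * ka * x)).
  { unfold pA. auto_derive; [exact I|ring]. }
  set (q := fun y => sqrt (pu y * (1 - y))) in *.
  change pb with (fun y => 2 * rho * q y / pA y).
  auto_derive; [repeat split; try (eexists; eassumption); lra|].
  rewrite (is_derive_unique _ _ _ H1 : Derive (fun x : R => q x) y = _),
    (is_derive_unique _ _ _ H2 : Derive (fun x : R => pA x) y = _).
  unfold gl, pb. fold (q y). fold (q y) in Hs, Hs2.
  replace (pu y) with (q y ^ 2 / (1 - y)) by (rewrite Hs2; field; lra).
  field. repeat split; lra.
Qed.

Lemma profile_derive_nonpos (y : R) : 0 <= y < 1 ->
  exists d, is_derive profile y d /\ d <= 0.
Proof.
  intros Hy. pose proof (pA_pos y ltac:(lra)) as HA. pose proof (pu_pos y ltac:(lra)) as Hu.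
  pose proof (pb_range y Hy) as Hb. pose proof (half_succ_pos m : 0 < lam) as Hlam.
  pose proof (Dl_pos y ltac:(lra)) as HDl.
  pose proof (pb_sq y ltac:(lra)) as Eb.
  set (k := mom m lam (pb y)). set (j := mom m (lam - 1) (pb y)).
  (* By [dmom_eq] the chain rule produces a moment of order [lam + 1], which [mom_reflection] turns
     into [j]; the derivatives thus stay in the span of [k] and [j]. *)
  assert (HK : is_derive (fun y => mom m lam (pb y)) y
     (gl y * (lam * (j * pA y ^ 2 / Dl y - k)))).
  { replace (gl y * (lam * (j * pA y ^ 2 / Dl y - k)))
      with (scal (gl y * pb y) (dmom m lam (pb y))).
    - apply (is_derive_comp (mom m lam) pb);
        [apply is_derive_mom; lra|apply is_derive_pb, Hy].
    - unfold scal; simpl; unfold mult; simpl. rewrite Rmult_assoc, dmom_eq by lra.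
      pose proof (mom_reflection m (pb y) ltac:(lra)) as Er. cbv zeta in Er. fold lam in Er.
      rewrite Eb in Er. fold j in Er. rewrite <- Er. fold k. field. split; lra. }
  assert (HJ : is_derive (fun y => mom m (lam - 1) (pb y)) y
     (gl y * ((lam - 1) * (k - j)))).
  { replace (gl y * ((lam - 1) * (k - j)))
      with (scal (gl y * pb y) (dmom m (lam - 1) (pb y))).
    - apply (is_derive_comp (mom m (lam - 1)) pb);
        [apply is_derive_mom; lra|apply is_derive_pb, Hy].
    - unfold scal; simpl; unfold mult; simpl. rewrite Rmult_assoc, dmom_eq by lra.
      replace (lam - 1 + 1) with lam by ring. reflexivity. }
  (* [S] is minus the numerator of [gl]: [gl y = - S / (2 * pu y * (1 - y) * pA y)], its [y^2] terms
     cancelling. The derivative of [profile] is then its positive prefactor times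
     [- lam / (2 * pu y * (1 - y)) * gap]. *)
  set (S := (1 + ka ^ 2 * x) * (1 + x) - 4 * ka * x + 2 * ka * x * y * (1 - ka) * be).
  set (gap := pA y * j * (be * S / Dl y + ka ^ 2 * x * (1 - y) - (lam - 1) * (1 - ka ^ 2 * x))
     - k * (be * (1 - ka ^ 2 * x) + be * (ka ^ 2 * x) * (1 - y) / lam - (lam - 1) * S)).
  assert (Hgap : 0 <= gap).
  { set (D := sqrt (Dl y)).
    assert (HD : 0 < D) by (apply sqrt_lt_R0, HDl).
    assert (HD2 : D ^ 2 = Dl y) by (apply pow2_sqrt; lra).
    assert (Esq : sqrt (1 - pb y ^ 2) = D / pA y).
    { rewrite Eb, <- HD2. replace (D ^ 2 / pA y ^ 2) with ((D / pA y) ^ 2) by (field; lra).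
      apply sqrt_pow2. left. apply Rdiv_lt_0_compat; lra. }
    pose proof (mom_lower m (pb y) ltac:(lra)) as B1. cbv zeta in B1. fold lam k j in B1.
    assert (B2 : 1 <= lam -> (2 * lam + 1) * j <= (2 * lam * sqrt (1 - pb y ^ 2) + 1) * k)
      by (apply (mom_upper m (pb y)); lra).
    rewrite Esq in B1, B2.
    pose proof (slope_inequality lam x y D k (pA y * j)) as SI. cbv zeta in SI.
    fold ka be S in SI. rewrite HD2 in SI.
    enough (E : k * (be * (1 - ka ^ 2 * x) + be * (ka ^ 2 * x) * (1 - y) / lam - (lam - 1) * S)
      <= pA y * j * (be * S / Dl y + ka ^ 2 * x * (1 - y) - (lam - 1) * (1 - ka ^ 2 * x)))
      by (unfold gap; lra).
    apply SI; clear SI.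
    - apply profile_lam_cases.
    - apply rho_sq_range.
    - lra.
    - exact HD.
    - reflexivity.
    - apply mom_pos; lra.
    - replace (D * k) with (pA y * (D / pA y * k)) by (field; lra).
      apply Rmult_le_compat_l; lra.
    - intros Hl. specialize (B2 Hl). fold (pA y).
      replace ((2 * lam + 1) * (pA y * j)) with (pA y * ((2 * lam + 1) * j)) by ring.
      replace ((2 * lam * D + pA y) * k) with (pA y * ((2 * lam * (D / pA y) + 1) * k))
        by (field; lra).
      apply Rmult_le_compat_l; lra. }
  exists (Rpower (pu y) (lam - 1 / 2) * Rpower (pA y) (- lam)
          * (- (lam / (2 * pu y * (1 - y))) * gap)).
  split.
  - set (Kf := fun y => mom m lam (pb y)) in *.
    set (Jf := fun y => mom m (lam - 1) (pb y)) in *.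
    change profile with (fun y => Rpower (pu y) (lam - 1 / 2) * Rpower (pA y) (- lam)
      * (be * Kf y + lam * pA y * Jf y)).
    assert (Hu1 : is_derive pu y (- (ka ^ 2 * x))).
    { unfold pu. auto_derive; [exact I|ring]. }
    assert (HA1 : is_derive pA y (- 2 * ka * x)).
    { unfold pA. auto_derive; [exact I|ring]. }
    unfold Rpower. auto_derive.
    + repeat split; try (eexists; eassumption); lra.
    + rewrite (is_derive_unique _ _ _ Hu1 : Derive (fun x : R => pu x) y = _),
        (is_derive_unique _ _ _ HA1 : Derive (fun x : R => pA x) y = _),
        (is_derive_unique _ _ _ HK : Derive (fun x : R => Kf x) y = _),
        (is_derive_unique _ _ _ HJ : Derive (fun x : R => Jf x) y = _).
      change (Kf y) with k. change (Jf y) with j.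
      replace (lam + - (1 / 2)) with (lam - 1 / 2) by ring.
      set (e1 := exp ((lam - 1 / 2) * ln (pu y))). set (e2 := exp (- lam * ln (pA y))).
      unfold gap, gl, S. clear - HA Hu HDl Hlam Hy.
      set (d := Dl y) in *. clearbody d k j e1 e2.
      unfold pA, pu, be in *. field. repeat split; lra.
  - set (e := Rpower (pu y) (lam - 1 / 2) * Rpower (pA y) (- lam)).
    assert (He : 0 < e) by (apply Rmult_lt_0_compat; apply exp_pos).
    set (q := lam / (2 * pu y * (1 - y))).
    assert (Hq : 0 < q) by (apply Rdiv_lt_0_compat; [lra|apply Rmult_lt_0_compat; lra]).
    clearbody e q gap.
    assert (0 <= e * (q * gap)) by (repeat apply Rmult_le_pos; lra).
    lra.
Qed.

Lemma profile_decreasing (y z : R) : 0 <= y -> y <= z -> z < 1 -> profile z <= profile y.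
Proof.
  intros H0 Hyz H1. destruct (Req_dec y z) as [->|Hne]; [apply Rle_refl|].
  destruct (MVT_cor2 profile (fun t => Derive profile t) y z) as [c [Hc Hcr]]; [lra| |].
  - intros t Ht. apply is_derive_Reals, Derive_correct.
    destruct (profile_derive_nonpos t ltac:(lra)) as [d [Hd _]]. exists d; exact Hd.
  - destruct (profile_derive_nonpos c ltac:(lra)) as [d [Hd Hle]].
    rewrite (is_derive_unique _ _ _ Hd) in Hc. nra.
Qed.
End Profile.

(** * Calculus on the interval *)

(** Differentiability is asked in the interior only, because the square-root weights need not be
    differentiable at the endpoints. *)
Lemma mean_value (f df : R -> R) (a b : R) : a < b ->
  (forall x, a < x < b -> is_derive f x (df x)) ->
  (forall x, a <= x <= b -> continuous f x) ->
  exists c, a < c < b /\ f b - f a = df c * (b - a).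
Proof.
  intros Hab Hd Hc.
  assert (pr1 : forall c, a < c < b -> derivable_pt f c).
  { intros c Hcab. exists (df c). apply is_derive_Reals, Hd, Hcab. }
  destruct (MVT f id a b pr1 (fun c _ => derivable_pt_id c) Hab) as [c [P E]].
  - intros c Hcab. apply continuity_pt_filterlim, Hc, Hcab.
  - intros c _. apply derivable_continuous_pt, derivable_pt_id.
  - exists c. split; [exact P|].
    rewrite derive_pt_id, Rmult_1_r in E. unfold id in E.
    rewrite <- E, Rmult_comm. f_equal.
    rewrite <- (is_derive_unique _ _ _ (Hd c P)). apply Derive_Reals.
Qed.

Lemma RInt_antiderivative (f P : R -> R) (a b : R) : a <= b ->
  (forall x, continuous f x) -> (forall x, a <= x <= b -> continuous P x) ->
  (forall x, a < x < b -> is_derive P x (f x)) -> RInt f a b = P b - P a.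
Proof.
  intros Hab Hf HP Hd.
  destruct (Req_dec a b) as [->|Hne].
  { rewrite RInt_point. unfold zero; simpl. ring. }
  assert (HI : forall x, is_derive (fun x => RInt f a x) x (f x)).
  { intros x. apply (is_derive_RInt f (fun x => RInt f a x) a x); [|apply Hf].
    apply filter_forall. intros y. apply (RInt_correct (V := R_CompleteNormedModule)).
    apply (ex_RInt_continuous (V := R_CompleteNormedModule)). intros; apply Hf. }
  destruct (mean_value (fun x => P x - RInt f a x) (fun x => f x - f x) a b)
    as [c [_ E]]; [lra| | |].
  - intros x Hx. apply (is_derive_minus (K := R_AbsRing) (V := R_NormedModule) P);
      [apply Hd, Hx|apply HI].
  - intros x Hx. apply continuous_Rminus; [apply HP, Hx|].
    apply (ex_derive_continuous (fun x => RInt f a x)). eexists; apply HI.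
  - rewrite RInt_point in E. unfold zero in E; simpl in E. lra.
Qed.

Lemma convex_of_second_derivative (g g1 g2 : R -> R) :
  (forall t, -1 <= t <= 1 -> continuous g t) ->
  (forall t, -1 < t < 1 -> is_derive g t (g1 t)) ->
  (forall t, -1 < t < 1 -> is_derive g1 t (g2 t)) ->
  (forall t, -1 < t < 1 -> 0 <= g2 t) -> convex_on_interval g (-1) 1.
Proof.
  intros Hc Hd1 Hd2 Hpos.
  assert (Hmono : forall a b, -1 < a -> a < b -> b < 1 -> g1 a <= g1 b).
  { intros a b Ha Hab Hb.
    destruct (mean_value g1 g2 a b) as [c [Hcab E]]; [exact Hab| | |].
    - intros; apply Hd2; lra.
    - intros x Hx. apply (ex_derive_continuous g1). eexists; apply Hd2; lra.
    - pose proof (Hpos c ltac:(lra)). nra. }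
  assert (Hlt : forall x y l, -1 <= x -> x < y -> y <= 1 -> 0 < l < 1 ->
    g (l * x + (1 - l) * y) <= l * g x + (1 - l) * g y).
  { intros x y l Hx Hxy Hy Hl. set (z := l * x + (1 - l) * y).
    assert (Hxz : z - x = (1 - l) * (y - x)) by (unfold z; ring).
    assert (Hzy : y - z = l * (y - x)) by (unfold z; ring).
    assert (0 < (1 - l) * (y - x)) by (apply Rmult_lt_0_compat; lra).
    assert (0 < l * (y - x)) by (apply Rmult_lt_0_compat; lra).
    destruct (mean_value g g1 x z) as [c1 [Hc1 E1]]; [lra| | |].
    { intros; apply Hd1; lra. } { intros; apply Hc; lra. }
    destruct (mean_value g g1 z y) as [c2 [Hc2 E2]]; [lra| | |].
    { intros; apply Hd1; lra. } { intros; apply Hc; lra. }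
    pose proof (Hmono c1 c2 ltac:(lra) ltac:(lra) ltac:(lra)) as Hm.
    rewrite Hxz in E1. rewrite Hzy in E2.
    assert (0 <= (g1 c2 - g1 c1) * (l * (1 - l) * (y - x))).
    { apply Rmult_le_pos; [lra|]. repeat apply Rmult_le_pos; lra. }
    replace (g x) with (g z - g1 c1 * ((1 - l) * (y - x))) by lra.
    replace (g y) with (g z + g1 c2 * (l * (y - x))) by lra. lra. }
  intros x y l Hx Hy Hl.
  destruct (Req_dec l 0) as [->|Hl0].
  { replace (0 * x + (1 - 0) * y) with y by ring. lra. }
  destruct (Req_dec l 1) as [->|Hl1].
  { replace (1 * x + (1 - 1) * y) with x by ring. lra. }
  destruct (Rtotal_order x y) as [H|[->|H]].
  - apply Hlt; lra.
  - replace (l * y + (1 - l) * y) with y by ring. lra.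
  - pose proof (Hlt y x (1 - l) ltac:(lra) H ltac:(lra) ltac:(lra)) as E.
    replace (1 - (1 - l)) with l in E by ring.
    rewrite (Rplus_comm (l * x)), (Rplus_comm (l * g x)). exact E.
Qed.

(** * Powers of [sqrt (1 - x^2)], their primitives, and the integrals in [F] and [G] *)

Definition sw (p : nat) (x : R) : R := sqrt (1 - x ^ 2) ^ p.

(** No range for [x] is required, since [sqrt] is 0 on negative numbers and continuous on the whole
    line. *)
Lemma continuous_sw (p : nat) (x : R) : continuous (sw p) x.
Proof.
  apply (continuous_comp (fun x => sqrt (1 - x ^ 2)) (fun y => y ^ p)).
  - apply (continuous_comp (fun x => 1 - x ^ 2) sqrt); [|apply continuous_sqrt].
    apply (ex_derive_continuous (fun x => 1 - x ^ 2)). auto_derive; exact I.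
  - apply (ex_derive_continuous (fun y => y ^ p)). auto_derive; exact I.
Qed.

Lemma one_sub_sq_pos (x : R) : -1 < x < 1 -> 0 < 1 - x ^ 2.
Proof. intros; nra. Qed.

Lemma sw_pos (p : nat) (x : R) : -1 < x < 1 -> 0 < sw p x.
Proof. intros Hx. apply pow_lt, sqrt_lt_R0, one_sub_sq_pos, Hx. Qed.

Lemma sw_SS (p : nat) (x : R) : -1 <= x <= 1 -> sw (p + 2) x = (1 - x ^ 2) * sw p x.
Proof.
  intros Hx. unfold sw. rewrite pow_add, pow2_sqrt by nra. ring.
Qed.

Lemma sw_opp (p : nat) (x : R) : sw p (- x) = sw p x.
Proof. unfold sw. replace ((- x) ^ 2) with (x ^ 2) by ring. reflexivity. Qed.

Lemma is_derive_sw (p : nat) (x : R) : -1 < x < 1 ->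
  is_derive (sw (p + 2)) x (- (INR p + 2) * x * sw p x).
Proof.
  intros Hx. pose proof (one_sub_sq_pos x Hx) as Hp.
  assert (Hs : 0 < sqrt (1 - x ^ 2)) by (apply sqrt_lt_R0, Hp).
  replace (p + 2)%nat with (S (S p)) by lia.
  assert (H : is_derive (fun x => sqrt (1 - x ^ 2)) x (- x / sqrt (1 - x ^ 2))).
  { auto_derive; [simpl in Hp; lra|].
    replace (1 + - (x * (x * 1))) with (1 - x ^ 2) by ring. field. lra. }
  unfold sw.
  pose proof (is_derive_pow (fun x => sqrt (1 - x ^ 2)) (S (S p)) x _ H) as E.
  replace (- (INR p + 2) * x * sqrt (1 - x ^ 2) ^ p)
    with (INR (S (S p)) * (- x / sqrt (1 - x ^ 2)) * sqrt (1 - x ^ 2) ^ pred (S (S p)));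
    [exact E|].
  rewrite !S_INR. simpl pred. simpl pow. simpl pow in Hs. field. lra.
Qed.

Definition swint (p : nat) (x : R) : R := RInt (sw p) 0 x.

Lemma is_derive_swint (p : nat) (x : R) : is_derive (swint p) x (sw p x).
Proof.
  apply (is_derive_RInt (sw p) (swint p) 0 x); [|apply continuous_sw].
  apply filter_forall. intros y. apply (RInt_correct (V := R_CompleteNormedModule)).
  apply (ex_RInt_continuous (V := R_CompleteNormedModule)). intros; apply continuous_sw.
Qed.

Lemma continuous_swint (p : nat) (x : R) : continuous (swint p) x.
Proof. apply (ex_derive_continuous (swint p)). eexists; apply is_derive_swint. Qed.

Lemma swint_opp (p : nat) (x : R) : swint p (- x) = - swint p x.
Proof.
  assert (Hex : forall a b, is_RInt (sw p) a b (RInt (sw p) a b)).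
  { intros a b. apply (RInt_correct (V := R_CompleteNormedModule)).
    apply (ex_RInt_continuous (V := R_CompleteNormedModule)). intros; apply continuous_sw. }
  unfold swint.
  pose proof (is_RInt_comp_opp (V := R_NormedModule) (sw p) 0 x (RInt (sw p) 0 (- x))) as E.
  rewrite Ropp_0 in E. specialize (E (Hex 0 (- x))).
  apply (is_RInt_unique (V := R_CompleteNormedModule)) in E. rewrite <- E.
  transitivity (opp (RInt (sw p) 0 x)); [|reflexivity].
  rewrite <- (RInt_opp (V := R_CompleteNormedModule)) by (eexists; apply Hex).
  apply RInt_ext. intros y _. rewrite sw_opp. reflexivity.
Qed.

Lemma RInt_abs_split (h P : R -> R) (tau : R) : -1 < tau < 1 ->
  (forall x, continuous h x) -> (forall x, continuous P x) ->
  (forall x, -1 < x < 1 -> is_derive P x ((tau - x) * h x)) ->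
  RInt (fun x => Rabs (tau - x) * h x) (-1) 1 = 2 * P tau - P (-1) - P 1.
Proof.
  intros Ht Hh HP Hd.
  assert (Hc : forall x, continuous (fun x => Rabs (tau - x) * h x) x).
  { intros x. apply continuous_Rmult; [|apply Hh].
    apply (continuous_comp (fun x => tau - x) Rabs); [|apply continuous_Rabs].
    apply continuous_Rminus; [apply continuous_const|apply continuous_id]. }
  assert (Hex : forall a b, ex_RInt (fun x => Rabs (tau - x) * h x) a b).
  { intros a b. apply (ex_RInt_continuous (V := R_CompleteNormedModule)). intros; apply Hc. }
  rewrite <- (RInt_Chasles (V := R_CompleteNormedModule) _ (-1) tau 1) by apply Hex.
  unfold plus; simpl.
  assert (Hc2 : forall x, continuous (fun x => (tau - x) * h x) x).
  { intros x. apply continuous_Rmult; [|apply Hh].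
    apply continuous_Rminus; [apply continuous_const|apply continuous_id]. }
  rewrite (RInt_ext (fun x => Rabs (tau - x) * h x) (fun x => (tau - x) * h x) (-1) tau).
  2:{ intros x. rewrite Rmin_left, Rmax_right by lra. intros Hx.
      rewrite Rabs_pos_eq by lra. reflexivity. }
  rewrite (RInt_ext (fun x => Rabs (tau - x) * h x) (fun x => - ((tau - x) * h x)) tau 1).
  2:{ intros x. rewrite Rmin_left, Rmax_right by lra. intros Hx.
      rewrite Rabs_left by lra. apply Ropp_mult_distr_l_reverse. }
  rewrite (RInt_antiderivative _ P (-1) tau); [|lra|exact Hc2|intros; apply HP|].
  2:{ intros; apply Hd; lra. }
  rewrite (RInt_antiderivative _ (fun x => - P x) tau 1); [ring|lra| | |].
  - intros x. apply (continuous_opp (K := R_AbsRing) (V := R_NormedModule)), Hc2.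
  - intros x _. apply (continuous_opp (K := R_AbsRing) (V := R_NormedModule)), HP.
  - intros x Hx. apply (is_derive_opp P x), Hd. lra.
Qed.

Lemma sw_at_1 (p : nat) : sw (p + 2) 1 = 0.
Proof.
  unfold sw. replace (1 - 1 ^ 2) with 0 by ring.
  rewrite sqrt_0, pow_add. simpl; ring.
Qed.

(** In [P (-1) + P 1] the odd function [swint m] cancels and [sw (m + 2)] vanishes, so only the
    value at [tau] survives. *)
Lemma RInt_abs_sw (m : nat) (tau : R) : -1 < tau < 1 ->
  RInt (fun x => Rabs (tau - x) * sw m x) (-1) 1
  = 2 * tau * swint m tau + 2 / (INR m + 2) * sw (m + 2) tau.
Proof.
  intros Ht. pose proof (pos_INR m) as Hm.
  rewrite (RInt_abs_split (sw m) (fun x => tau * swint m x + / (INR m + 2) * sw (m + 2) x)).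
  - replace (-1) with (- (1)) by ring. rewrite swint_opp, sw_opp, sw_at_1.
    match goal with |- @eq _ ?a ?b => change (@eq R a b) end. field. lra.
  - exact Ht.
  - intros; apply continuous_sw.
  - intros x. apply continuous_Rplus; apply continuous_Rmult;
      (apply continuous_const || apply continuous_swint || apply continuous_sw).
  - intros x Hx.
    pose proof (is_derive_swint m x) as H1. pose proof (is_derive_sw m x Hx) as H2.
    auto_derive; [repeat split; eexists; eassumption|].
    rewrite (is_derive_unique _ _ _ H1 : Derive (fun x : R => swint m x) x = _),
      (is_derive_unique _ _ _ H2 : Derive (fun x : R => sw (m + 2) x) x = _). field. lra.
Qed.

Lemma RInt_abs_sw_mul (m : nat) (tau : R) : -1 < tau < 1 ->
  RInt (fun x => Rabs (tau - x) * sw m x * x) (-1) 1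
  = - 2 / (INR m + 2) * swint (m + 2) tau.
Proof.
  intros Ht. pose proof (pos_INR m) as Hm.
  rewrite (RInt_ext _ (fun x => Rabs (tau - x) * (sw m x * x)))
    by (intros; apply Rmult_assoc).
  (* The primitive comes from integration by parts, [x * sw m x] being the derivative of
     [- sw (m + 2) x / (m + 2)]. *)
  rewrite (RInt_abs_split (fun x => sw m x * x) (fun x => / (INR m + 2) *
    (- (tau - x) * sw (m + 2) x - swint (m + 2) x))).
  - replace (-1) with (- (1)) by ring. rewrite swint_opp, sw_opp, sw_at_1.
    match goal with |- @eq _ ?a ?b => change (@eq R a b) end. field. lra.
  - exact Ht.
  - intros; apply continuous_Rmult; [apply continuous_sw|apply continuous_id].
  - intros x. apply continuous_Rmult; [apply continuous_const|].
    apply continuous_Rminus; [|apply continuous_swint].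
    apply continuous_Rmult; [|apply continuous_sw].
    apply (continuous_opp (K := R_AbsRing) (V := R_NormedModule) (fun x => tau - x)).
    apply continuous_Rminus; [apply continuous_const|apply continuous_id].
  - intros x Hx.
    pose proof (is_derive_swint (m + 2) x) as H1. pose proof (is_derive_sw m x Hx) as H2.
    auto_derive; [repeat split; eexists; eassumption|].
    rewrite (is_derive_unique _ _ _ H1 : Derive (fun x : R => swint (m + 2) x) x = _),
      (is_derive_unique _ _ _ H2 : Derive (fun x : R => sw (m + 2) x) x = _). field. lra.
Qed.

(** * Termwise expansion *)

Definition ngeg (mu : R) (j : nat) (a : R) : R := / gegenbauer mu j 1 * gegenbauer mu j a.

(** At [x = 1] the second order term of the Gegenbauer equation disappears. *)
Lemma gegenbauer_at_1_shift (mu : R) (j : nat) :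
  (INR j + 1) * (INR j + 1 + 2 * mu) * gegenbauer mu (S j) 1
  = (2 * mu + 1) * (2 * mu) * gegenbauer (mu + 1) j 1.
Proof.
  pose proof (gegenbauer_ode mu (S j) 1) as H. rewrite S_INR in H. simpl dgeg in H. lra.
Qed.

Lemma is_derive_ngeg (mu : R) (j : nat) (a : R) : 0 < mu ->
  is_derive (ngeg mu (S j)) a
    ((INR j + 1) * (INR j + 1 + 2 * mu) / (2 * mu + 1) * ngeg (mu + 1) j a).
Proof.
  intros Hmu. unfold ngeg. pose proof (gegenbauer_at_1_shift mu j) as E.
  pose proof (gegenbauer_at_1_pos mu (S j) Hmu) as H1.
  pose proof (gegenbauer_at_1_pos (mu + 1) j ltac:(lra)) as H2.
  pose proof (pos_INR j) as Hj.
  replace (_ * _) with (/ gegenbauer mu (S j) 1 * dgeg mu (S j) a).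
  { apply (is_derive_scal (gegenbauer mu (S j))), is_derive_gegenbauer. }
  simpl dgeg.
  replace (gegenbauer mu (S j) 1) with ((2 * mu + 1) * (2 * mu) * gegenbauer (mu + 1) j 1
     / ((INR j + 1) * (INR j + 1 + 2 * mu))) by (rewrite <- E; field; lra).
  field. repeat split; lra.
Qed.

Lemma ngeg_ode (mu : R) (j : nat) (a : R) : 0 < mu ->
  (1 - a ^ 2) * ((INR j + 1) * (INR j + 3 + 2 * mu)) / ((2 * mu + 1) * (2 * mu + 3))
    * ngeg (mu + 1 + 1) j a
  = a * ngeg (mu + 1) (S j) a - ngeg mu (S (S j)) a.
Proof.
  intros Hmu. pose proof (gegenbauer_ode mu (S (S j)) a) as O.
  simpl dgeg in O. simpl ddgeg in O. rewrite !S_INR in O.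
  pose proof (gegenbauer_at_1_shift mu (S j)) as E1. rewrite S_INR in E1.
  pose proof (gegenbauer_at_1_shift (mu + 1) j) as E2.
  pose proof (gegenbauer_at_1_pos mu (S (S j)) Hmu) as H1.
  pose proof (gegenbauer_at_1_pos (mu + 1) (S j) ltac:(lra)) as H2.
  pose proof (gegenbauer_at_1_pos (mu + 1 + 1) j ltac:(lra)) as H3.
  pose proof (pos_INR j) as Hj. unfold ngeg.
  set (g1 := gegenbauer mu (S (S j)) 1) in *. set (g2 := gegenbauer (mu + 1) (S j) 1) in *.
  set (g3 := gegenbauer (mu + 1 + 1) j 1) in *.
  set (c1 := gegenbauer mu (S (S j)) a) in *. set (c2 := gegenbauer (mu + 1) (S j) a) in *.
  set (c3 := gegenbauer (mu + 1 + 1) j a) in *.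
  assert (G2 : g2 = (INR j + 1 + 1) * (INR j + 1 + 1 + 2 * mu) * g1
                    / ((2 * mu + 1) * (2 * mu))) by (rewrite E1; field; lra).
  assert (G3 : g3 = (INR j + 1) * (INR j + 1 + 2 * (mu + 1)) * g2
                    / ((2 * (mu + 1) + 1) * (2 * (mu + 1)))) by (rewrite E2; field; lra).
  rewrite G2 in G3. rewrite G2, G3. clear E1 E2 G2 G3.
  apply (Rmult_eq_reg_l (g1 * ((INR j + 1 + 1) * (INR j + 1 + 1 + 2 * mu)))).
  2:{ apply Rgt_not_eq. repeat apply Rmult_lt_0_compat; lra. }
  transitivity ((1 - a ^ 2) * (2 * mu * (2 * (mu + 1) * c3))); [field; lra|].
  transitivity ((2 * mu + 1) * a * (2 * mu * c2)
    - (INR j + 1 + 1) * (INR j + 1 + 1 + 2 * mu) * c1); [lra|field; lra].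
Qed.

(** A Rodrigues-type relation. Read backwards and used twice, it integrates [(1-a^2)^(lam-1/2) N_k]
    and raises parameter and exponent by 2: this is the origin of the parameter [(n+2)/2] and the
    power [(n+1)/2] in [H]. *)
Lemma is_derive_ngeg_sw (mu : R) (p j : nat) (a : R) :
  0 < mu -> 2 * mu = INR p + 1 -> -1 < a < 1 ->
  is_derive (fun a => ngeg (mu + 1) j a * sw (p + 2) a) a
    (- (2 * mu + 1) * (ngeg mu (S j) a * sw p a)).
Proof.
  intros Hmu Hp Ha.
  pose proof (is_derive_sw p a Ha) as H1.
  destruct j as [|j].
  - apply (is_derive_ext (sw (p + 2))).
    { intros t. unfold ngeg. rewrite !gegenbauer_0, Rinv_1. symmetry.
      rewrite Rmult_assoc, !Rmult_1_l. reflexivity. }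
    replace (_ * _) with (- (INR p + 2) * a * sw p a); [exact H1|].
    unfold ngeg. rewrite !gegenbauer_1. replace (INR p) with (2 * mu - 1) by lra.
    field. lra.
  - pose proof (is_derive_ngeg (mu + 1) j a ltac:(lra)) as H2.
    pose proof (ngeg_ode mu j a Hmu) as O.
    pose proof (is_derive_mult (K := R_AbsRing) _ _ _ _ _ H2 H1 Rmult_comm) as H.
    unfold plus, mult in H; simpl in H.
    match type of H with is_derive _ _ ?d =>
      replace (- (2 * mu + 1) * (ngeg mu (S (S j)) a * sw p a)) with d; [exact H|] end.
    rewrite (sw_SS p a) by lra. replace (INR p) with (2 * mu - 1) by lra.
    replace (ngeg mu (S (S j)) a) with (a * ngeg (mu + 1) (S j) a
      - (1 - a ^ 2) * ((INR j + 1) * (INR j + 3 + 2 * mu)) / ((2 * mu + 1) * (2 * mu + 3))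
        * ngeg (mu + 1 + 1) j a) by lra.
    field. lra.
Qed.

Lemma ngeg_opp (mu : R) (j : nat) (a : R) : ngeg mu j (- a) = (-1) ^ j * ngeg mu j a.
Proof. unfold ngeg. rewrite gegenbauer_opp. ring. Qed.

Lemma ngeg_bound (mu : R) (j : nat) (a : R) : 0 < mu -> -1 <= a <= 1 -> Rabs (ngeg mu j a) <= 1.
Proof.
  intros Hmu Ha. unfold ngeg. pose proof (gegenbauer_at_1_pos mu j Hmu) as H1.
  rewrite Rabs_mult, Rabs_pos_eq by (left; apply Rinv_0_lt_compat, H1).
  apply (Rmult_le_reg_l (gegenbauer mu j 1)); [exact H1|].
  rewrite <- Rmult_assoc, Rinv_r, Rmult_1_l, Rmult_1_r by lra.
  apply gegenbauer_bound; assumption.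
Qed.

Lemma dgeg_opp (lam : R) (k : nat) (x : R) : dgeg lam k (- x) = - (-1) ^ k * dgeg lam k x.
Proof. destruct k as [|k]; simpl; [ring|]. rewrite gegenbauer_opp. ring. Qed.

Lemma ddgeg_opp (lam : R) (k : nat) (x : R) : ddgeg lam k (- x) = (-1) ^ k * ddgeg lam k x.
Proof. destruct k as [|k]; simpl; [ring|]. rewrite dgeg_opp. ring. Qed.

(** * The terms of the expansion and the equation that each of them satisfies *)

Section Expansion.
Variables (m : nat) (rho : R).
Hypothesis Hrho : 0 < rho < 1.
Let lam := (INR m + 1) / 2.
Let ka := lam / (lam + 1).
Let de := ka * rho.

Lemma delta_range : 0 < de < 1.
Proof.
  assert (Hka : 0 < ka < 1) by (apply div_add_1_bounds, half_succ_pos).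
  unfold de. split; nra.
Qed.

Lemma delta_mul_range (t : R) : -1 <= t <= 1 -> -1 < de * t < 1.
Proof. intros Ht. pose proof delta_range. split; nra. Qed.

(* [coefA k] has second derivative [coefA2 k]; [fterm 0], [fterm 1] and [fterm (k + 2)] are [F], [G]
   and the terms of [H]. *)
Definition coefA (k : nat) (a : R) : R :=
  match k with
  | O => 2 * a * swint m a + 2 / (INR m + 2) * sw (m + 2) a
  | S O => rho * (- 2 / (INR m + 2) * swint (m + 2) a)
  | S (S j) => 2 / ((2 * lam + 1) * (2 * lam + 3)) * rho ^ k
               * (ngeg (lam + 1 + 1) j a * sw (m + 2 + 2) a)
  end.

Definition coefA1 (k : nat) (a : R) : R :=
  match k with
  | O => 2 * swint m a
  | S j => - (2 / (2 * lam + 1)) * rho ^ k * (ngeg (lam + 1) j a * sw (m + 2) a)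
  end.

Definition coefA2 (k : nat) (a : R) : R := 2 * rho ^ k * (ngeg lam k a * sw m a).

Lemma is_derive_coefA (k : nat) (a : R) : -1 < a < 1 ->
  is_derive (coefA k) a (coefA1 k a).
Proof.
  intros Ha. pose proof (half_succ_pos m : 0 < lam) as Hl. pose proof (pos_INR m).
  destruct k as [|[|j]]; simpl coefA; simpl coefA1.
  - pose proof (is_derive_swint m a) as H1. pose proof (is_derive_sw m a Ha) as H2.
    change (coefA 0) with (fun a => 2 * a * swint m a + 2 / (INR m + 2) * sw (m + 2) a).
    auto_derive; [repeat split; eexists; eassumption|].
    rewrite (is_derive_unique _ _ _ H1 : Derive (fun x : R => swint m x) a = _),
      (is_derive_unique _ _ _ H2 : Derive (fun x : R => sw (m + 2) x) a = _). field. lra.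
  - pose proof (is_derive_swint (m + 2) a) as H1.
    change (coefA 1) with (fun a => rho * (- 2 / (INR m + 2) * swint (m + 2) a)).
    auto_derive; [repeat split; eexists; eassumption|].
    rewrite (is_derive_unique _ _ _ H1 : Derive (fun x : R => swint (m + 2) x) a = _).
    unfold ngeg. rewrite !gegenbauer_0. unfold lam. field. lra.
  - pose proof (is_derive_ngeg_sw (lam + 1) (m + 2) j a ltac:(lra)
      ltac:(rewrite plus_INR; unfold lam; simpl; field) Ha) as H1.
    pose proof (is_derive_scal _ _ (2 / ((2 * lam + 1) * (2 * lam + 3)) * rho ^ S (S j)) _ H1)
      as H2.
    replace (- (2 / (2 * lam + 1)) * (rho * (rho * rho ^ j))
      * (ngeg (lam + 1) (S j) a * sw (m + 2) a))
      with (2 / ((2 * lam + 1) * (2 * lam + 3)) * rho ^ S (S j)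
        * (- (2 * (lam + 1) + 1) * (ngeg (lam + 1) (S j) a * sw (m + 2) a)));
      [exact H2|simpl pow; field; lra].
Qed.

Lemma is_derive_coefA1 (k : nat) (a : R) : -1 < a < 1 ->
  is_derive (coefA1 k) a (coefA2 k a).
Proof.
  intros Ha. pose proof (half_succ_pos m : 0 < lam) as Hl. unfold coefA2.
  destruct k as [|j]; simpl coefA1.
  - replace (2 * rho ^ 0 * (ngeg lam 0 a * sw m a)) with (2 * sw m a).
    + apply (is_derive_scal (swint m)), is_derive_swint.
    + unfold ngeg. rewrite !gegenbauer_0. simpl; field.
  - pose proof (is_derive_ngeg_sw lam m j a Hl ltac:(unfold lam; field) Ha) as H1.
    pose proof (is_derive_scal _ _ (- (2 / (2 * lam + 1)) * rho ^ S j) _ H1) as H2.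
    replace (2 * rho ^ S j * (ngeg lam (S j) a * sw m a))
      with (- (2 / (2 * lam + 1)) * rho ^ S j * (- (2 * lam + 1) * (ngeg lam (S j) a * sw m a)));
      [exact H2|field; lra].
Qed.

(** For [k >= 2] this is [ngeg_ode] times [2 rho^k (1 - a^2)] and the weight [sw m a]; for [k <= 1]
    the primitives [swint] cancel. *)
Lemma coefA_ode (k : nat) (a : R) : -1 < a < 1 ->
  (1 - a ^ 2) * coefA2 k a + (2 * lam + 1) * (a * coefA1 k a - coefA k a)
  = - (INR k * (INR k + 2 * lam)) * coefA k a.
Proof.
  intros Ha. pose proof (half_succ_pos m : 0 < lam) as Hl. unfold coefA2.
  assert (Hm : INR m = 2 * lam - 1) by (unfold lam; field).
  destruct k as [|[|j]].
  - simpl coefA; simpl coefA1. unfold ngeg. rewrite !gegenbauer_0, sw_SS, Hm by lra.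
    simpl. field. lra.
  - simpl coefA; simpl coefA1. unfold ngeg.
    rewrite !gegenbauer_0, !gegenbauer_1, (sw_SS m a), Hm by lra.
    simpl. field. lra.
  - simpl coefA; simpl coefA1.
    pose proof (ngeg_ode lam j a Hl) as O.
    rewrite (sw_SS (m + 2) a), (sw_SS m a), !S_INR by lra.
    replace (ngeg lam (S (S j)) a) with (a * ngeg (lam + 1) (S j) a
      - (1 - a ^ 2) * ((INR j + 1) * (INR j + 3 + 2 * lam)) / ((2 * lam + 1) * (2 * lam + 3))
        * ngeg (lam + 1 + 1) j a) by lra.
    simpl pow. field. lra.
Qed.

Lemma coefA_opp (k : nat) (a : R) : coefA k (- a) = (-1) ^ k * coefA k a.
Proof.
  destruct k as [|[|j]]; simpl coefA.
  - rewrite swint_opp, sw_opp. simpl; ring.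
  - rewrite swint_opp. simpl; ring.
  - rewrite ngeg_opp, sw_opp. simpl; ring.
Qed.

Lemma coefA1_opp (k : nat) (a : R) : coefA1 k (- a) = - (-1) ^ k * coefA1 k a.
Proof.
  destruct k as [|j]; simpl coefA1.
  - rewrite swint_opp. simpl; ring.
  - rewrite ngeg_opp, sw_opp. simpl; ring.
Qed.

Lemma coefA2_opp (k : nat) (a : R) : coefA2 k (- a) = (-1) ^ k * coefA2 k a.
Proof. unfold coefA2. rewrite ngeg_opp, sw_opp. ring. Qed.

Definition fterm (k : nat) (t : R) : R := coefA k (de * t) * gegenbauer lam k t.
Definition fterm1 (k : nat) (t : R) : R :=
  de * coefA1 k (de * t) * gegenbauer lam k t + coefA k (de * t) * dgeg lam k t.
Definition fterm2 (k : nat) (t : R) : R :=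
  de ^ 2 * coefA2 k (de * t) * gegenbauer lam k t
  + 2 * de * coefA1 k (de * t) * dgeg lam k t + coefA k (de * t) * ddgeg lam k t.
Definition eterm (k : nat) (t : R) : R :=
  (1 - (de * t) ^ 2 + (1 - t ^ 2) * de ^ 2) * coefA2 k (de * t) * gegenbauer lam k t
  + 2 * de * (1 - t ^ 2) * coefA1 k (de * t) * dgeg lam k t.

Lemma is_derive_fterm (k : nat) (t : R) : -1 <= t <= 1 ->
  is_derive (fterm k) t (fterm1 k t).
Proof.
  intros Ht. pose proof (is_derive_coefA k (de * t) (delta_mul_range t Ht)) as H1.
  pose proof (is_derive_gegenbauer lam k t) as H2. unfold fterm, fterm1.
  auto_derive; [repeat split; eexists; eassumption|].
  rewrite (is_derive_unique _ _ _ H1 : Derive (fun x : R => coefA k x) (de * t) = _),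
    (is_derive_unique _ _ _ H2 : Derive (fun x : R => gegenbauer lam k x) t = _). ring.
Qed.

Lemma is_derive_fterm1 (k : nat) (t : R) : -1 <= t <= 1 ->
  is_derive (fterm1 k) t (fterm2 k t).
Proof.
  intros Ht. pose proof (is_derive_coefA k (de * t) (delta_mul_range t Ht)) as H1.
  pose proof (is_derive_coefA1 k (de * t) (delta_mul_range t Ht)) as H3.
  pose proof (is_derive_gegenbauer lam k t) as H2.
  pose proof (is_derive_dgeg lam k t) as H4. unfold fterm1, fterm2.
  auto_derive; [repeat split; eexists; eassumption|].
  rewrite (is_derive_unique _ _ _ H1 : Derive (fun x : R => coefA k x) (de * t) = _),
    (is_derive_unique _ _ _ H3 : Derive (fun x : R => coefA1 k x) (de * t) = _),
    (is_derive_unique _ _ _ H2 : Derive (fun x : R => gegenbauer lam k x) t = _),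
    (is_derive_unique _ _ _ H4 : Derive (fun x : R => dgeg lam k x) t = _). ring.
Qed.

(** The eigenvalue terms of [coefA_ode] and [gegenbauer_ode] cancel, and with them the first order
    terms in [coefA1 * gegenbauer] and [coefA * dgeg]. *)
Lemma fterm_ode (k : nat) (t : R) : -1 <= t <= 1 ->
  (1 - t ^ 2) * fterm2 k t + (2 * lam + 1) * (fterm k t - t * fterm1 k t) = eterm k t.
Proof.
  intros Ht. pose proof (coefA_ode k (de * t) (delta_mul_range t Ht)) as O1.
  pose proof (gegenbauer_ode lam k t) as O2. unfold fterm, fterm1, fterm2, eterm.
  set (A := coefA k (de * t)) in *. set (A1 := coefA1 k (de * t)) in *.
  set (A2 := coefA2 k (de * t)) in *. set (C := gegenbauer lam k t) in *.
  set (C1 := dgeg lam k t) in *. set (C2 := ddgeg lam k t) in *.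
  set (mu := INR k * (INR k + 2 * lam)) in *.
  apply Rminus_diag_uniq.
  transitivity (A * ((1 - t ^ 2) * C2 - (2 * lam + 1) * t * C1 + mu * C)
    - C * ((1 - (de * t) ^ 2) * A2 + (2 * lam + 1) * (de * t * A1 - A) - - mu * A)); [ring|].
  rewrite O2, O1. ring.
Qed.

Lemma fterm2_opp (k : nat) (t : R) : fterm2 k (- t) = fterm2 k t.
Proof.
  unfold fterm2. replace (de * - t) with (- (de * t)) by ring.
  rewrite coefA_opp, coefA1_opp, coefA2_opp, gegenbauer_opp, dgeg_opp, ddgeg_opp.
  assert (E : (-1) ^ k * (-1) ^ k = 1).
  { rewrite <- Rpow_mult_distr. replace (-1 * -1) with 1 by ring. apply pow1. }
  match goal with |- ?lhs = ?rhs => transitivity ((-1) ^ k * (-1) ^ k * rhs);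
    [ring|rewrite E; ring] end.
Qed.

(** Differentiation lowers the degree by one and raises the parameter, so the second kernel sum
    stops at [N] when the first runs to [S N]. *)
Lemma sum_eterm (N : nat) (t : R) : -1 <= t <= 1 ->
  sum_f_R0 (fun k => eterm k t) (S N)
  = 2 * sw m (de * t)
    * ((1 - (de * t) ^ 2 + (1 - t ^ 2) * de ^ 2)
       * sum_f_R0 (fun k => / gegenbauer lam k 1 * gegenbauer lam k (de * t)
                            * gegenbauer lam k t * rho ^ k) (S N)
       - 4 * lam * de * rho / (2 * lam + 1) * (1 - t ^ 2) * (1 - (de * t) ^ 2)
         * sum_f_R0 (fun k => / gegenbauer (lam + 1) k 1 * gegenbauer (lam + 1) k (de * t)
                            * gegenbauer (lam + 1) k t * rho ^ k) N).
Proof.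
  intros Ht. pose proof (delta_mul_range t Ht) as Ha. pose proof (half_succ_pos m : 0 < lam) as Hl.
  set (a := de * t) in *.
  set (R0 := 1 - a ^ 2 + (1 - t ^ 2) * de ^ 2).
  set (c := 4 * lam * de * rho / (2 * lam + 1) * (1 - t ^ 2) * (1 - a ^ 2)).
  assert (ES : forall j, eterm (S j) t = 2 * sw m a * R0 * (/ gegenbauer lam (S j) 1
       * gegenbauer lam (S j) a * gegenbauer lam (S j) t * rho ^ (S j))
     - 2 * sw m a * c * (/ gegenbauer (lam + 1) j 1 * gegenbauer (lam + 1) j a
                            * gegenbauer (lam + 1) j t * rho ^ j)).
  { intros j. unfold eterm, coefA2, coefA1, ngeg. fold a R0. simpl dgeg.
    rewrite (sw_SS m a) by lra. unfold c. simpl pow. field.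
    pose proof (gegenbauer_at_1_pos lam (S j) Hl).
    pose proof (gegenbauer_at_1_pos (lam + 1) j ltac:(lra)). repeat split; lra. }
  assert (E0 : eterm 0 t = 2 * sw m a * R0 * (/ gegenbauer lam 0 1
       * gegenbauer lam 0 a * gegenbauer lam 0 t * rho ^ 0)).
  { unfold eterm, coefA2, coefA1, ngeg. fold a R0. simpl dgeg. simpl pow. ring. }
  induction N as [|N IH].
  - simpl sum_f_R0. rewrite E0, ES. fold R0. ring.
  - rewrite tech5, IH, ES, (tech5 _ (S N)),
      (tech5 (fun k => / gegenbauer (lam + 1) k 1 * _ * _ * _) N).
    ring.
Qed.
End Expansion.

(** * Passage to the limit *)

Lemma sqrt_pow_Rpower (z : R) (p : nat) : 0 < z -> sqrt z ^ p = Rpower z (INR p / 2).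
Proof.
  intros Hz. rewrite <- Rpower_pow by (apply sqrt_lt_R0, Hz).
  rewrite <- Rpower_sqrt by exact Hz. rewrite Rpower_mult. f_equal. field.
Qed.

Lemma cint_Rpower_scale (m : nat) (A B s : R) : 0 < A -> -1 < B / A < 1 ->
  / cint m (fun _ => 1) * cint m (fun v => Rpower (A - B * v) (- s))
  = Rpower A (- s) * mom m s (B / A).
Proof.
  intros HA HB. unfold mom.
  rewrite (cint_ext m (fun v => Rpower (A - B * v) (- s))
    (fun v => Rpower A (- s) * Rpower (1 - B / A * v) (- s))).
  - rewrite cint_scal by cont_pw. ring.
  - intros v Hv. rewrite Rpower_mult_distr; [|exact HA|apply one_sub_mul_pos; assumption].
    f_equal. field. lra.
Qed.

Section Limit.
Variables (m : nat) (rho : R).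
Hypothesis Hrho : 0 < rho < 1.
Let lam := (INR m + 1) / 2.
Let ka := lam / (lam + 1).
Let de := ka * rho.

Lemma limit_profile (t : R) : 0 <= t < 1 ->
  let a := de * t in
  2 * sw m a
    * ((1 - a ^ 2 + (1 - t ^ 2) * de ^ 2)
       * (/ cint m (fun _ => 1) * cint m (fun v => Rpower (1 + rho ^ 2 - 2 * rho * (a * t)
          - 2 * rho * (sqrt (1 - a ^ 2) * sqrt (1 - t ^ 2)) * v) (- lam)))
       - 4 * lam * de * rho / (2 * lam + 1) * (1 - t ^ 2) * (1 - a ^ 2)
         * (/ cint (m + 2) (fun _ => 1)
            * cint (m + 2) (fun v => Rpower (1 + rho ^ 2 - 2 * rho * (a * t)
          - 2 * rho * (sqrt (1 - a ^ 2) * sqrt (1 - t ^ 2)) * v) (- (lam + 1)))))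
  = 2 / (lam + 1) * profile m rho (t ^ 2).
Proof.
  intros Ht a. pose proof (delta_mul_range m rho Hrho t ltac:(lra)) as Ha.
  fold lam ka de in Ha. change (-1 < a < 1) in Ha.
  pose proof (half_succ_pos m : 0 < lam) as Hl.
  assert (Hy : 0 <= t ^ 2 < 1) by nra.
  pose proof (pA_pos m rho Hrho (t ^ 2) ltac:(lra)) as HA.
  pose proof (pu_pos m rho Hrho (t ^ 2) ltac:(lra)) as Hu.
  pose proof (pb_range m rho Hrho (t ^ 2) Hy) as Hb.
  assert (EA : 1 + rho ^ 2 - 2 * rho * (a * t) = pA m rho (t ^ 2)).
  { unfold pA, a, de. fold lam ka. ring. }
  assert (Eu : 1 - a ^ 2 = pu m rho (t ^ 2)).
  { unfold pu, a, de. fold lam ka. ring. }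
  assert (EB : 2 * rho * (sqrt (1 - a ^ 2) * sqrt (1 - t ^ 2)) / pA m rho (t ^ 2)
     = pb m rho (t ^ 2)).
  { unfold pb. rewrite <- sqrt_mult by (rewrite ?Eu; lra). rewrite Eu. reflexivity. }
  rewrite !EA, !cint_Rpower_scale by (rewrite ?EB; lra). rewrite !EB.
  pose proof (mom_SS m (pb m rho (t ^ 2)) ltac:(lra)) as E. cbv zeta in E. fold lam in E.
  unfold sw. rewrite sqrt_pow_Rpower by lra. rewrite Eu.
  replace (INR m / 2) with (lam - 1 / 2) by (unfold lam; field).
  rewrite (Rpower_succ (pA m rho (t ^ 2)) lam) by exact HA.
  unfold profile. fold lam ka. rewrite (Rpower_succ (pA m rho (t ^ 2)) lam) by exact HA.
  assert (Eb2 : pb m rho (t ^ 2) ^ 2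
    = 4 * rho ^ 2 * pu m rho (t ^ 2) * (1 - t ^ 2) / pA m rho (t ^ 2) ^ 2).
  { unfold pb. replace ((2 * rho * sqrt (pu m rho (t ^ 2) * (1 - t ^ 2)) / pA m rho (t ^ 2)) ^ 2)
      with (4 * rho ^ 2 * sqrt (pu m rho (t ^ 2) * (1 - t ^ 2)) ^ 2 / pA m rho (t ^ 2) ^ 2)
      by (field; lra).
    rewrite pow2_sqrt by (apply Rmult_le_pos; lra). field. lra. }
  rewrite Eb2 in E. set (k := mom m lam (pb m rho (t ^ 2))) in *.
  set (j := mom m (lam - 1) (pb m rho (t ^ 2))) in *.
  set (k2 := mom (m + 2) (lam + 1) (pb m rho (t ^ 2))) in *.
  (* By [mom_SS], the factors [1 - t^2] and [1 - a^2] of the second kernel are absorbed into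
     [b^2 = B^2 / A^2]. *)
  assert (Ek : 4 * lam * de * rho / (2 * lam + 1) * (1 - t ^ 2) * pu m rho (t ^ 2) * k2
    = ka * pA m rho (t ^ 2) ^ 2 * (k - j)).
  { transitivity (ka * pA m rho (t ^ 2) ^ 2 / (2 * lam + 1)
      * (lam * (4 * rho ^ 2 * pu m rho (t ^ 2) * (1 - t ^ 2) / pA m rho (t ^ 2) ^ 2) * k2)).
    - unfold de. field. split; lra.
    - rewrite E. field. lra. }
  set (e1 := Rpower (pu m rho (t ^ 2)) (lam - 1 / 2)).
  set (e2 := Rpower (pA m rho (t ^ 2)) (- (lam + 1))).
  transitivity (2 * e1 * e2 * ((pu m rho (t ^ 2) + (1 - t ^ 2) * de ^ 2) * pA m rho (t ^ 2) * k
    - 4 * lam * de * rho / (2 * lam + 1) * (1 - t ^ 2) * pu m rho (t ^ 2) * k2)); [ring|].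
  rewrite Ek. clearbody e1 e2 k j k2.
  (* The coefficient of [k] loses its dependence on [t]: [pu + (1 - t^2) de^2 - ka pA = (1 - ka) (1
     - ka rho^2)], where [1 - ka = 1 / (lam + 1)]. *)
  unfold pu, pA, de. fold lam ka. unfold ka. field. lra.
Qed.

Lemma sum_eterm_uniform : exists eps : nat -> R, is_lim_seq eps 0 /\
  forall N t, 0 <= t < 1 ->
  Rabs (sum_f_R0 (fun k => eterm m rho k t) (S N)
        - 2 / (lam + 1) * profile m rho (t ^ 2)) <= eps N.
Proof.
  pose proof (half_succ_pos m : 0 < lam) as Hl.
  destruct (kernel_uniform m rho Hrho) as [e1 [He1 H1]]. cbv zeta in H1. fold lam in H1.
  destruct (kernel_uniform (m + 2) rho Hrho) as [e2 [He2 H2]]. cbv zeta in H2.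
  replace ((INR (m + 2) + 1) / 2) with (lam + 1) in H2
    by (rewrite plus_INR; unfold lam; simpl; field).
  (* Each 4 bounds the factor in front of one kernel, [2 * w * R0] and [2 * w * c] below. *)
  exists (fun N => 4 * e1 (S N) + 4 * e2 N). split.
  { replace (Finite 0) with (Finite (4 * 0 + 4 * 0)) by (f_equal; ring).
    apply is_lim_seq_plus'; apply is_lim_seq_mult'; try apply is_lim_seq_const;
      [apply (is_lim_seq_incr_1 e1)|]; assumption. }
  intros N t Ht. pose proof (delta_range m rho Hrho) as Hde. fold lam ka de in Hde.
  pose proof (delta_mul_range m rho Hrho t ltac:(lra)) as Ha. fold lam ka de in Ha.
  rewrite (sum_eterm m rho Hrho) by lra. rewrite <- limit_profile by exact Ht.
  cbv zeta. fold lam ka de. set (a := de * t) in *.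
  specialize (H1 a t (S N) ltac:(lra) ltac:(lra)).
  specialize (H2 a t N ltac:(lra) ltac:(lra)).
  match type of H1 with Rabs (?s1 - ?i1) <= _ => set (S1 := s1) in *; set (I1 := i1) in * end.
  match type of H2 with Rabs (?s2 - ?i2) <= _ => set (S2 := s2) in *; set (I2 := i2) in * end.
  set (w := sw m a). set (R0 := 1 - a ^ 2 + (1 - t ^ 2) * de ^ 2).
  set (c := 4 * lam * de * rho / (2 * lam + 1) * (1 - t ^ 2) * (1 - a ^ 2)).
  replace (_ - _) with (2 * w * R0 * (S1 - I1) + - (2 * w * c) * (S2 - I2)) by ring.
  assert (Hw : 0 <= w <= 1).
  { unfold w. split; [left; apply sw_pos, Ha|]. unfold sw.
    apply Rle_trans with (1 ^ m); [apply pow_incr|rewrite pow1; lra].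
    split; [apply sqrt_pos|]. apply Rle_trans with (sqrt 1); [|rewrite sqrt_1; lra].
    apply sqrt_le_1_alt. pose proof (pow2_ge_0 a); lra. }
  assert (Ht2 : 0 <= 1 - t ^ 2 <= 1) by nra.
  assert (Ha2 : 0 <= 1 - a ^ 2 <= 1) by nra.
  assert (HR : 0 <= R0 <= 2).
  { unfold R0. assert (0 <= de ^ 2 <= 1) by nra.
    assert (0 <= (1 - t ^ 2) * de ^ 2 <= 1) by nra. lra. }
  assert (Hc : 0 <= c <= 2).
  { unfold c. assert (Hf : 0 <= 4 * lam * de * rho / (2 * lam + 1) <= 2).
    { assert (0 <= de * rho <= 1) by nra.
      replace (4 * lam * de * rho / (2 * lam + 1)) with (4 * lam / (2 * lam + 1) * (de * rho))
        by (field; lra).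
      assert (0 <= 4 * lam / (2 * lam + 1) <= 2).
      { split; [apply Rdiv_le_0_compat; lra|].
        apply (Rmult_le_reg_r (2 * lam + 1)); [lra|]. field_simplify; lra. }
      nra. }
    assert (0 <= (1 - t ^ 2) * (1 - a ^ 2) <= 1) by nra.
    rewrite Rmult_assoc. nra. }
  clearbody w R0 c.
  eapply Rle_trans; [apply Rabs_triang|].
  rewrite !Rabs_mult, Rabs_Ropp, !Rabs_mult, !(Rabs_pos_eq 2), (Rabs_pos_eq w),
    (Rabs_pos_eq R0), (Rabs_pos_eq c) by lra.
  pose proof (Rabs_pos (S1 - I1)). pose proof (Rabs_pos (S2 - I2)).
  assert (0 <= 2 * w * R0 <= 4) by nra. assert (0 <= 2 * w * c <= 4) by nra.
  apply Rplus_le_compat; apply Rmult_le_compat; lra.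
Qed.

Definition fsum (N : nat) (t : R) : R := sum_f_R0 (fun k => fterm m rho k t) N.
Definition fsum1 (N : nat) (t : R) : R := sum_f_R0 (fun k => fterm1 m rho k t) N.
Definition fsum2 (N : nat) (t : R) : R := sum_f_R0 (fun k => fterm2 m rho k t) N.

Lemma is_derive_fsum (N : nat) (t : R) : -1 <= t <= 1 -> is_derive (fsum N) t (fsum1 N t).
Proof.
  intros Ht. apply (is_derive_sum_f_R0 (fterm m rho) (fterm1 m rho)).
  intros; apply is_derive_fterm; assumption.
Qed.

Lemma is_derive_fsum1 (N : nat) (t : R) : -1 <= t <= 1 -> is_derive (fsum1 N) t (fsum2 N t).
Proof.
  intros Ht. apply (is_derive_sum_f_R0 (fterm1 m rho) (fterm2 m rho)).
  intros; apply is_derive_fterm1; assumption.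
Qed.

Lemma fsum_ode (N : nat) (t : R) : -1 <= t <= 1 ->
  (1 - t ^ 2) * fsum2 N t + (2 * lam + 1) * (fsum N t - t * fsum1 N t)
  = sum_f_R0 (fun k => eterm m rho k t) N.
Proof.
  intros Ht. unfold fsum, fsum1, fsum2. induction N as [|N IH].
  - simpl. apply fterm_ode; assumption.
  - rewrite !tech5, <- IH, <- (fterm_ode m rho Hrho) by exact Ht. fold lam. ring.
Qed.

(* [f - t f'] solves a first order equation with right-hand side [- t (E - C)]; the monotone
   profile bounds [E] by its value at [t], hence [f - t f'] at [t], hence [f''] at [t]. *)
Lemma fsum2_lower (N : nat) (e : R) :
  (forall t, 0 <= t < 1 -> Rabs (sum_f_R0 (fun k => eterm m rho k t) N
        - 2 / (lam + 1) * profile m rho (t ^ 2)) <= e) ->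
  forall t, -1 < t < 1 -> - 2 * e <= (1 - t ^ 2) * fsum2 N t.
Proof.
  intros He. pose proof (half_succ_pos m : 0 < lam) as Hl.
  set (E := fun t => 2 / (lam + 1) * profile m rho (t ^ 2)).
  assert (HE : forall t, 0 <= t < 1 ->
    E t - e <= sum_f_R0 (fun k => eterm m rho k t) N <= E t + e).
  { intros t Ht. specialize (He t Ht). apply Rabs_le_between' in He. exact He. }
  assert (Hmono : forall s t, 0 <= s -> s <= t -> t < 1 -> E t <= E s).
  { intros s t H0 Hst H1. unfold E. apply Rmult_le_compat_l.
    - apply Rdiv_le_0_compat; lra.
    - apply (profile_decreasing m rho Hrho); nra. }
  assert (Hpos : forall t, 0 <= t < 1 -> - 2 * e <= (1 - t ^ 2) * fsum2 N t).
  { intros t0 Ht0.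
    (* [(2 * lam + 1) * C] bounds the sum of the [eterm] on all of [[t0, 1)], which fixes the sign
       of [Z1] there. *)
    set (C := (E t0 + e) / (2 * lam + 1)).
    set (Z := fun t => sw (m + 2) t * (fsum N t - t * fsum1 N t - C)).
    set (Z1 := fun t => - t * sw m t
       * (sum_f_R0 (fun k => eterm m rho k t) N - (2 * lam + 1) * C)).
    destruct (mean_value Z Z1 t0 1) as [s [Hs EZ]]; [lra| | |].
    - intros t Ht. pose proof (is_derive_sw m t ltac:(lra)) as H1.
      pose proof (is_derive_fsum N t ltac:(lra)) as H2.
      pose proof (is_derive_fsum1 N t ltac:(lra)) as H3.
      unfold Z, Z1. rewrite <- fsum_ode by lra.
      auto_derive; [repeat split; eexists; eassumption|].
      rewrite (is_derive_unique _ _ _ H1 : Derive (fun x : R => sw (m + 2) x) t = _),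
        (is_derive_unique _ _ _ H2 : Derive (fun x : R => fsum N x) t = _),
        (is_derive_unique _ _ _ H3 : Derive (fun x : R => fsum1 N x) t = _).
      rewrite sw_SS by lra. replace (INR m) with (2 * lam - 1) by (unfold lam; field). ring.
    - intros t Ht. unfold Z. apply continuous_Rmult; [apply continuous_sw|].
      apply continuous_Rminus; [|apply continuous_const].
      apply continuous_Rminus; [|apply continuous_Rmult; [apply continuous_id|]].
      + apply (ex_derive_continuous (fsum N)). eexists; apply is_derive_fsum; lra.
      + apply (ex_derive_continuous (fsum1 N)). eexists; apply is_derive_fsum1; lra.
    - assert (HZ1 : 0 <= Z1 s).
      { unfold Z1. pose proof (sw_pos m s ltac:(lra)).
        pose proof (proj2 (HE s ltac:(lra))) as B.
        pose proof (Hmono t0 s ltac:(lra) ltac:(lra) ltac:(lra)) as M.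
        replace ((2 * lam + 1) * C) with (E t0 + e) by (unfold C; field; lra).
        assert (0 <= s * sw m s * (E t0 + e - sum_f_R0 (fun k => eterm m rho k s) N)).
        { repeat apply Rmult_le_pos; lra. }
        lra. }
      assert (HZ : Z t0 <= 0).
      { assert (Z 1 = 0) by (unfold Z; rewrite sw_at_1; ring).
        assert (0 <= Z1 s * (1 - t0)) by (apply Rmult_le_pos; lra). lra. }
      assert (HD : fsum N t0 - t0 * fsum1 N t0 <= C).
      { unfold Z in HZ. pose proof (sw_pos (m + 2) t0 ltac:(lra)). nra. }
      pose proof (fsum_ode N t0 ltac:(lra)) as O.
      pose proof (proj1 (HE t0 Ht0)) as B.
      assert ((2 * lam + 1) * (fsum N t0 - t0 * fsum1 N t0) <= E t0 + e).
      { replace (E t0 + e) with ((2 * lam + 1) * C) by (unfold C; field; lra).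
        apply Rmult_le_compat_l; lra. }
      lra. }
  intros t Ht. destruct (Rle_dec 0 t) as [H0|H0]; [apply Hpos; lra|].
  replace (t ^ 2) with ((- t) ^ 2) by ring.
  replace (fsum2 N t) with (fsum2 N (- t)); [apply Hpos; lra|].
  unfold fsum2. apply sum_eq. intros k _. apply fterm2_opp.
Qed.

(* [- sqrt (1 - t^2)] has second derivative [(1-t^2)^(-3/2) >= 1/(1-t^2)] and is continuous up to
   the endpoints, so it absorbs the error. *)
Lemma fsum_convex (N : nat) (e : R) : 0 <= e ->
  (forall t, 0 <= t < 1 -> Rabs (sum_f_R0 (fun k => eterm m rho k t) N
        - 2 / (lam + 1) * profile m rho (t ^ 2)) <= e) ->
  convex_on_interval (fun t => fsum N t - 2 * e * sqrt (1 - t ^ 2)) (-1) 1.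
Proof.
  intros He HeE. pose proof (fsum2_lower N e HeE) as Hlow.
  apply (convex_of_second_derivative _
    (fun t => fsum1 N t + 2 * e * (t / sqrt (1 - t ^ 2)))
    (fun t => fsum2 N t + 2 * e / sqrt (1 - t ^ 2) ^ 3)).
  - intros t Ht. apply continuous_Rminus.
    + apply (ex_derive_continuous (fsum N)). eexists; apply is_derive_fsum, Ht.
    + apply continuous_Rmult; [apply continuous_const|].
      apply (continuous_ext (sw 1)); [intros; apply pow_1|apply continuous_sw].
  - intros t Ht. pose proof (one_sub_sq_pos t Ht) as Hp.
    assert (0 < sqrt (1 - t ^ 2)) by (apply sqrt_lt_R0, Hp).
    pose proof (is_derive_fsum N t ltac:(lra)) as H1.
    auto_derive; [repeat split; [eexists; eassumption|simpl in Hp; lra]|].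
    rewrite (is_derive_unique _ _ _ H1 : Derive (fun x : R => fsum N x) t = _).
    replace (1 + - (t * (t * 1))) with (1 - t ^ 2) by ring. field. lra.
  - intros t Ht. pose proof (one_sub_sq_pos t Ht) as Hp.
    assert (Hs : 0 < sqrt (1 - t ^ 2)) by (apply sqrt_lt_R0, Hp).
    assert (Hs2 : sqrt (1 - t ^ 2) ^ 2 = 1 - t ^ 2) by (apply pow2_sqrt; lra).
    pose proof (is_derive_fsum1 N t ltac:(lra)) as H1.
    auto_derive.
    + replace (1 + - (t * (t * 1))) with (1 - t ^ 2) by ring.
      repeat split; [eexists; eassumption|lra|lra].
    + rewrite (is_derive_unique _ _ _ H1 : Derive (fun x : R => fsum1 N x) t = _).
      replace (1 + - (t * (t * 1))) with (1 - t ^ 2) by ring.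
      set (q := sqrt (1 - t ^ 2)) in *.
      transitivity (fsum2 N t + 2 * e * (q ^ 2 + t ^ 2) / q ^ 3); [field; lra|].
      rewrite Hs2. field. lra.
  - intros t Ht. pose proof (one_sub_sq_pos t Ht) as Hp. specialize (Hlow t Ht).
    set (q := sqrt (1 - t ^ 2)).
    assert (Hs : 0 < q) by (apply sqrt_lt_R0, Hp).
    assert (Hs2 : q ^ 2 = 1 - t ^ 2) by (apply pow2_sqrt; lra).
    assert (Hq1 : q <= 1) by nra.
    apply (Rmult_le_reg_l (q ^ 3)); [apply pow_lt, Hs|].
    replace (q ^ 3 * (fsum2 N t + 2 * e / q ^ 3))
      with (q * (q ^ 2 * fsum2 N t) + 2 * e) by (field; lra).
    rewrite Hs2, Rmult_0_r.
    assert (q * (- 2 * e) <= q * ((1 - t ^ 2) * fsum2 N t)) by (apply Rmult_le_compat_l; lra).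
    nra.
Qed.

(** * Identification with [F], [G], [H] and the limit *)

Let n := (m + 3)%nat.

Lemma delta_eq : delta n rho = de.
Proof.
  unfold delta, de, ka, lam, n. rewrite plus_INR. pose proof (pos_INR m). simpl. field. lra.
Qed.

Lemma F_eq (t : R) : -1 <= t <= 1 -> F n rho t = fterm m rho 0 t.
Proof.
  intros Ht. unfold F, fterm. rewrite delta_eq, gegenbauer_0, Rmult_1_r. fold lam ka de.
  simpl coefA. rewrite <- RInt_abs_sw by (apply (delta_mul_range m rho Hrho t Ht)).
  unfold n. replace (m + 3 - 3)%nat with m by lia. reflexivity.
Qed.

Lemma G_eq (t : R) : -1 <= t <= 1 -> G n rho t = fterm m rho 1 t.
Proof.
  intros Ht. unfold G, fterm. rewrite delta_eq, gegenbauer_1. fold lam ka de.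
  simpl coefA. rewrite <- RInt_abs_sw_mul by (apply (delta_mul_range m rho Hrho t Ht)).
  unfold n. replace (m + 3 - 3)%nat with m by lia.
  replace (INR (m + 3) - 2) with (2 * lam) by (rewrite plus_INR; unfold lam; simpl; field).
  unfold sw. ring.
Qed.

Lemma H_lim (t : R) : -1 <= t <= 1 ->
  is_lim_seq (fun N => sum_f_R0 (fun j => fterm m rho (S (S j)) t) N) (H n rho t).
Proof.
  intros Ht. pose proof (half_succ_pos m : 0 < lam) as Hl.
  pose proof (delta_mul_range m rho Hrho t Ht) as Ha. fold lam ka de in Ha.
  assert (Hn : INR n = 2 * lam + 2) by (unfold n; rewrite plus_INR; unfold lam; simpl; field).
  unfold H. rewrite delta_eq.
  match goal with |- context [Series ?f] => set (b := f) end.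
  (* The factor [j! / (n+2)_j] is the inverse of the value at 1 of the polynomial with parameter
     [(n+2)/2], so it normalises that polynomial. *)
  assert (Eb : forall j, b j = ngeg (lam + 1 + 1) j (de * t)
    * gegenbauer lam (S (S j)) t * rho ^ S (S j)).
  { intros j. unfold b, ngeg. rewrite Hn.
    replace ((2 * lam + 2 + 2) / 2) with (lam + 1 + 1) by field.
    replace ((2 * lam + 2 - 2) / 2) with lam by field.
    replace (j + 2)%nat with (S (S j)) by lia.
    rewrite (gegenbauer_at_1 (lam + 1 + 1)).
    replace (2 * (lam + 1 + 1)) with (2 * lam + 2 + 2) by ring.
    pose proof (poch_pos (2 * lam + 2 + 2) j ltac:(lra)). field.
    split; first [apply fact_ne | lra]. }
  assert (Hex : ex_series b).
  { apply (ex_series_ext (fun j => ngeg (lam + 1 + 1) j (de * t)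
      * gegenbauer lam (S (S j)) t * rho ^ S (S j))); [intros; symmetry; apply Eb|].
    apply (ex_series_le (K := R_AbsRing) (V := R_CompleteNormedModule) _
      (fun j => gegenbauer lam (S (S j)) 1 * rho ^ S (S j))).
    - intros j. change (norm ?z) with (Rabs z).
      change (Rabs (ngeg (lam + 1 + 1) j (de * t) * gegenbauer lam (S (S j)) t * rho ^ S (S j))
        <= gegenbauer lam (S (S j)) 1 * rho ^ S (S j)).
      assert (0 < rho ^ S (S j)) by (apply pow_lt; lra).
      rewrite !Rabs_mult, (Rabs_pos_eq (rho ^ S (S j))) by lra.
      apply Rmult_le_compat_r; [lra|].
      pose proof (ngeg_bound (lam + 1 + 1) j (de * t) ltac:(lra) ltac:(lra)).
      pose proof (gegenbauer_bound lam (S (S j)) t Hl Ht).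
      rewrite <- (Rmult_1_l (gegenbauer lam (S (S j)) 1)).
      apply Rmult_le_compat; try apply Rabs_pos; assumption.
    - apply (ex_series_incr_1 (fun j => gegenbauer lam (S j) 1 * rho ^ S j)).
      apply (ex_series_incr_1 (fun j => gegenbauer lam j 1 * rho ^ j)).
      apply ex_series_gegenbauer_at_1; assumption. }
  set (c0 := 2 / (INR n ^ 2 - 1) * sqrt (1 - de ^ 2 * t ^ 2) ^ (n + 1)).
  apply (is_lim_seq_ext (fun N => c0 * sum_f_R0 b N)).
  - intros N. rewrite scal_sum. apply sum_eq. intros j _. rewrite Eb. unfold fterm.
    fold lam ka de. simpl coefA. fold lam. unfold c0. rewrite Hn.
    unfold n. replace (m + 3 + 1)%nat with (m + 2 + 2)%nat by lia.
    unfold sw. replace ((de * t) ^ 2) with (de ^ 2 * t ^ 2) by ring.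
    simpl pow at 1. simpl (rho ^ S (S j)). field. split; nra.
  - apply (is_lim_seq_scal_l (sum_f_R0 b) c0 (Series b)).
    apply (is_lim_seq_ext (sum_n b)); [intros; apply sum_n_Reals|].
    apply Series_correct, Hex.
Qed.

(** For fixed [x], [y], [l] convexity is one inequality between three values, so pointwise
    convergence of the corrected partial sums is enough. *)
Lemma convex_at_lam : convex_on_interval (fun t => F n rho t + G n rho t + H n rho t) (-1) 1.
Proof.
  destruct sum_eterm_uniform as [eps [Hlim Heps]].
  assert (Hpos : forall N, 0 <= eps N).
  { intros N. eapply Rle_trans; [apply Rabs_pos|apply (Heps N 0); lra]. }
  intros x y l Hx Hy Hl.
  set (z := l * x + (1 - l) * y).
  assert (Hz : -1 <= z <= 1) by (unfold z; nra).
  (* The sum up to [S (S N)] consists of the [F] and [G] terms and the terms of [H] up to index [N];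
     its error is [eps (S N)] because [eps N] belongs to the sum up to [S N]. *)
  assert (Hconv : forall t, -1 <= t <= 1 ->
    is_lim_seq (fun N => fsum (S (S N)) t - 2 * eps (S N) * sqrt (1 - t ^ 2))
      (F n rho t + G n rho t + H n rho t)).
  { intros t Ht.
    replace (Finite (F n rho t + G n rho t + H n rho t))
      with (Finite (F n rho t + G n rho t + H n rho t - 2 * 0 * sqrt (1 - t ^ 2)))
      by (f_equal; ring).
    apply is_lim_seq_minus'.
    - apply (is_lim_seq_ext (fun N => F n rho t + G n rho t
        + sum_f_R0 (fun j => fterm m rho (S (S j)) t) N)).
      + intros N. rewrite F_eq, G_eq by exact Ht. unfold fsum.
        rewrite (decomp_sum _ (S (S N))) by lia. simpl pred.
        rewrite (decomp_sum _ (S N)) by lia. simpl pred. ring.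
      + apply is_lim_seq_plus'; [apply is_lim_seq_const|apply H_lim, Ht].
    - apply is_lim_seq_mult'; [|apply is_lim_seq_const].
      apply is_lim_seq_mult'; [apply is_lim_seq_const|].
      apply (is_lim_seq_incr_1 eps), Hlim. }
  apply (is_lim_seq_le
    (fun N => fsum (S (S N)) z - 2 * eps (S N) * sqrt (1 - z ^ 2))
    (fun N => l * (fsum (S (S N)) x - 2 * eps (S N) * sqrt (1 - x ^ 2))
       + (1 - l) * (fsum (S (S N)) y - 2 * eps (S N) * sqrt (1 - y ^ 2)))
    (F n rho z + G n rho z + H n rho z)
    (l * (F n rho x + G n rho x + H n rho x)
     + (1 - l) * (F n rho y + G n rho y + H n rho y))).
  - intros N. apply (fsum_convex (S (S N)) (eps (S N))); auto.
  - apply Hconv, Hz.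
  - apply is_lim_seq_plus'; apply is_lim_seq_mult'; try apply is_lim_seq_const;
      apply Hconv; assumption.
Qed.
End Limit.

Theorem theorem1p2 (n : nat) (rho : R) (hn : (3 <= n)%nat) (hrho : 0 < rho < 1) :
  convex_on_interval (fun t => F n rho t + G n rho t + H n rho t) (-1) 1.
Proof.
  (* Since [3 <= n], the truncated subtraction is exact and [m = n - 3] gives [lam = (n-2)/2]. *)
  replace n with (n - 3 + 3)%nat by lia. apply convex_at_lam, hrho.
Qed.
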